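(* Let $P\subset\mathbb R^n$ be a convex body containing $0$ in its interior, with Ricci affine function $\ell_P$. Suppose that $\inf_P\ell_P<0$. Let $\hat f\in\mathcal C_2(P)$ be the unique minimizer of $W_\ell$ over $\mathcal C_2(P)$ satisfying $\pi(\hat f)=0$ and $\int_P\hat f^2dy=\hat f(0)$. Then (1)-(4) hold: (1) Let $\mathfrak b=\hat f+\ell_P$. Then $\mathfrak b\ge0$, $\int_P\mathfrak b\,dy=1$ and $\int_Py_i\mathfrak b\,dy=0$ for $1\le i\le n$; hence $\mathfrak b\in\mathfrak B_P$. Moreover $\int_P\mathfrak b^2dy=\mathfrak b(0)$. (2) $\mathfrak b$ is the unique element of $\mathfrak B_P$ with the minimum $L^2$-norm. (3) For any convex $b\in\mathfrak B_P$ we have $\int_Pb^2dy\ge b(0)$, with equality if and only if $b=\mathfrak b$. (4) $\mathfrak b$ is a simple convex function, i.e. $\mathfrak b=\max\{0,\mathfrak a\}$, where $\mathfrak a$ is the unique affine function such that $$\int_{P\cap\{\mathfrak a>0\}}\mathfrak a\,dy=1,\qquad\int_{P\cap\{\mathfrak a>0\}}y_i\,\mathfrak a\,dy=0\quad\text{for }1\le i\le n.$$ (5) If instead $\inf_P\ell_P\ge0$, then $\ell_P$ is the unique element of $\mathfrak B_P$ with the minimum $L^2$-norm.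
   Context: A convex body is a compact convex subset of $\mathbb R^n$ with nonempty interior. The Ricci affine function $\ell_P$ is the unique affine function with $-h(0)+\int_Ph\,\ell_P\,dy=0$ for all affine $h$. $\mathcal C_2(P)=\{f:P\to\mathbb R\cup\{\infty\}\text{ convex}\mid f\in L^2(P)\}$ (such $f$ is finite on $\mathrm{Int}(P)$). $D_\ell^{\mathrm{NA}}(f)=-f(0)+\int_Pf\,\ell_P\,dy$; $\pi$ is the $L^2(P,dy)$-orthogonal projection onto affine functions; $W_\ell(f)=\frac{D_\ell^{\mathrm{NA}}(f)}{\|f-\pi(f)\|_2}$ for $f\in\mathcal C_2(P)$, set to be $0$ if the denominator vanishes, where $\|\cdot\|_2$ is the norm of $L^2(P,dy)$. (When $\inf_P\ell_P<0$, a minimizer with the stated normalization exists and is unique.) $\mathfrak B_P=\{0\le b\in L^2(P)\mid\int_Pb\,dy=1,\ \int_Py_ib\,dy=0\text{ for }1\le i\le n\}$. Functions are regarded up to null sets (equalities and uniqueness are in $L^2(P)$, and convex functions are compared on $\mathrm{Int}(P)$). *)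

(* Defs.v *)
From HB Require Import structures.
From mathcomp Require Import all_boot all_order all_algebra.
From mathcomp Require Import all_classical all_reals all_analysis.
From mathcomp Require Import measurable_realfun.

Set Implicit Arguments.
Unset Strict Implicit.
Unset Printing Implicit Defensive.
Import Order.TTheory GRing.Theory Num.Theory.
Import numFieldNormedType.Exports.

Local Open Scope classical_set_scope.
Local Open Scope ring_scope.

(* R^n is 'rV[R]_n, with the product (= Borel) sigma-algebra, as for tuples. *)
Definition rV_display : measure_display -> measure_display.
Proof. exact. Qed.

Section measurable_rV.
Context d (T : measurableType d) (n : nat).

Let coord : 'I_n -> 'rV[T]_n -> T := fun i x => x ord0 i.

Let rV_set0 : g_sigma_preimage coord set0.
Proof. exact: sigma_algebra0. Qed.

Let rV_setC A : g_sigma_preimage coord A -> g_sigma_preimage coord (~` A).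
Proof. exact: sigma_algebraC. Qed.

Let rV_bigcup (F : _^nat) : (forall i, g_sigma_preimage coord (F i)) ->
  g_sigma_preimage coord (\bigcup_i (F i)).
Proof. exact: sigma_algebra_bigcup. Qed.

HB.instance Definition _ := @isMeasurable.Build (rV_display d)
  'rV[T]_n (g_sigma_preimage coord) rV_set0 rV_setC rV_bigcup.

End measurable_rV.


Lemma measurable_rV_coord d (T : measurableType d) n (i : 'I_n) :
  measurable_fun [set: 'rV[T]_n] (fun x : 'rV[T]_n => x ord0 i).
Proof.
move=> _ Y mY; rewrite setTI; apply: sub_sigma_algebra => /=.
rewrite -bigcup_seq/=; exists i => /=; first by rewrite mem_index_enum.
by exists Y => //; rewrite setTI.
Qed.

Lemma measurable_fun_rV d1 (T1 : measurableType d1) d (T : measurableType d) n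
    (f : T1 -> 'rV[T]_n) :
  (forall i, measurable_fun setT (fun x => f x ord0 i)) ->
  measurable_fun setT f.
Proof.
move=> mf _ A mA; rewrite setTI.
suff : [set B : set 'rV[T]_n | measurable (f @^-1` B)] A by [].
apply: mA; split.
  split=> [|B /= mB|F /= mF].
  - by rewrite /= preimage_set0.
  - by rewrite setTD preimage_setC; exact: measurableC.
  - by rewrite preimage_bigcup; exact: bigcup_measurable.
rewrite -bigcup_seq => B [i _] [Y mY <-] /=; rewrite setTI.
by rewrite -comp_preimage -[X in measurable X]setTI; exact: mf.
Qed.

Section lebesgue_rVS.
Context (R : realType) (n : nat).
Variable m : {sigma_finite_measure set 'rV[R]_n -> \bar R}.

Definition rV_cons (p : measurableTypeR R * 'rV[R]_n) : 'rV[R]_n.+1 :=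
  row_mx (const_mx p.1 : 'rV_1) p.2.

Let rV_uncons (x : 'rV[R]_n.+1) : measurableTypeR R * 'rV[R]_n :=
  (x ord0 ord0, \row_j x ord0 (lift ord0 j)).

Lemma rV_cons0 p : rV_cons p ord0 ord0 = p.1.
Proof.
have -> : @ord0 n = lshift n (@ord0 0) by exact/val_inj.
by apply: etrans (row_mxEl _ _ _ _) _; rewrite mxE.
Qed.

Lemma rV_consS p j : rV_cons p ord0 (lift ord0 j) = p.2 ord0 j.
Proof.
have -> : lift ord0 j = rshift 1 j by exact/val_inj.
exact: row_mxEr.
Qed.

Let rV_consK : cancel rV_cons rV_uncons.
Proof.
move=> [a v]; rewrite /rV_uncons rV_cons0; congr (_, _).
by apply/rowP => j; rewrite mxE rV_consS.
Qed.

Lemma measurable_rV_cons : measurable_fun setT rV_cons.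
Proof.
apply: measurable_fun_rV => i; case: (unliftP ord0 i) => [j ->|->].
  under eq_fun do rewrite rV_consS.
  exact: measurableT_comp (measurable_rV_coord j) measurable_snd.
by under eq_fun do rewrite rV_cons0; exact: measurable_fst.
Qed.

Let measurable_rV_uncons : measurable_fun setT rV_uncons.
Proof.
apply: (@measurable_fun_pair _ _ _ _ (measurableTypeR R)).
  exact: measurable_rV_coord.
apply: measurable_fun_rV => j.
rewrite (_ : (fun _ => _) = (fun x : 'rV[R]_n.+1 => x ord0 (lift ord0 j))).
  exact: measurable_rV_coord.
by apply/funext => x; rewrite mxE.
Qed.

Let prod :
    {measure set (measurableTypeR R * 'rV[R]_n)%type -> \bar R} :=
  (@lebesgue_measure R \x m)%E.

Definition lebesgue_rVS : set 'rV[R]_n.+1 -> \bar R :=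
  pushforward (@lebesgue_measure R \x m)%E rV_cons.

Let lebesgue_rVS0 : lebesgue_rVS set0 = 0%E.
Proof. by rewrite /lebesgue_rVS /pushforward preimage_set0 (measure0 prod). Qed.

Let lebesgue_rVS_ge0 A : (0 <= lebesgue_rVS A)%E.
Proof. exact: (measure_ge0 prod). Qed.

Let lebesgue_rVS_sigma_additive : semi_sigma_additive lebesgue_rVS.
Proof.
have mc B : measurable B -> measurable (rV_cons @^-1` B).
  by move=> mB; rewrite -[X in measurable X]setTI; exact: measurable_rV_cons.
move=> F mF tF mUF; rewrite /lebesgue_rVS /pushforward preimage_bigcup.
apply: (@measure_semi_sigma_additive _ _ _ prod).
- by move=> k; exact: mc.
- apply/trivIsetP => /= i j _ _ ij; rewrite -preimage_setI.
  by move/trivIsetP : tF => /(_ _ _ _ _ ij) ->//; rewrite preimage_set0.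
- by rewrite -preimage_bigcup; exact: mc.
Qed.

HB.instance Definition _ := isMeasure.Build _ _ _ lebesgue_rVS
  lebesgue_rVS0 lebesgue_rVS_ge0 lebesgue_rVS_sigma_additive.

Let lebesgue_rVS_sigma_finite : sigma_finite setT lebesgue_rVS.
Proof.
have /sigma_finiteP[F [TF ndF Foo]] := sigma_finiteT (@lebesgue_measure R).
have /sigma_finiteP[G [TG ndG Goo]] := sigma_finiteT m.
exists (fun k => rV_uncons @^-1` (F k `*` G k)) => [|k].
  rewrite -preimage_bigcup (_ : \bigcup_i _ = setT) ?preimage_setT//.
  rewrite -subTset => -[x y] _.
  have : setT x by []. rewrite TF => -[i _ Fx].
  have : setT y by []. rewrite TG => -[j _ Gy].
  exists (maxn i j) => //; split.
  - by move: x Fx; exact/subsetPset/ndF/leq_maxl.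
  - by move: y Gy; exact/subsetPset/ndG/leq_maxr.
have [mF Fk] := Foo k; have [mG Gk] := Goo k; split.
  rewrite -[X in measurable X]setTI; apply: measurable_rV_uncons => //.
  exact: measurableX.
rewrite /lebesgue_rVS /pushforward -comp_preimage.
rewrite (_ : _ \o _ = id); last by apply/funext => p; exact: rV_consK.
by rewrite /= product_measure1E// lte_mul_pinfty// ge0_fin_numE.
Qed.

HB.instance Definition _ := Measure_isSigmaFinite.Build _ _ _ lebesgue_rVS
  lebesgue_rVS_sigma_finite.

End lebesgue_rVS.

(* n-dimensional Lebesgue measure, by R^0 = {0} and R^(n+1) = R x R^n. *)
Fixpoint lebesgue_rV (R : realType) (n : nat) :
    {sigma_finite_measure set 'rV[R]_n -> \bar R} :=
  match n with
  | 0 => @dirac _ 'rV[R]_0 0 R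
  | k.+1 => lebesgue_rVS (lebesgue_rV R k)
  end.

Lemma lebesgue_rV_box (R : realType) (n : nat) (A : 'I_n -> set R) :
  (forall i, measurable (A i)) ->
  lebesgue_rV R n [set x | forall i, A i (x ord0 i)] =
  (\prod_(i < n) lebesgue_measure (A i))%E.
Proof.
elim: n A => [|n IH] A mA.
  by rewrite big_ord0 /= diracE mem_set// => -[].
pose B := [set x : 'rV[R]_n | forall i : 'I_n, A (lift ord0 i) (x ord0 i)].
have mB : measurable B.
  have -> : B = \bigcap_(i in [set: 'I_n]) [set x | A (lift ord0 i) (x ord0 i)].
    by apply/seteqP; split=> [x h i _|x h i]; exact: h.
  apply: fin_bigcap_measurable => // i _.
  rewrite -[X in measurable X]setTI.
  exact: (measurable_rV_coord (T := R) i measurableT (mA _)).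
rewrite big_ord_recl -(IH (fun i => A (lift ord0 i)))// -/B.
rewrite -(product_measure1E (lebesgue_measure (R := R)) _ (mA ord0) mB).
congr (product_measure1 _ _ _); apply/seteqP; split => -[a v] /=.
  by move=> h; split=> [|i];
    [have := h ord0; rewrite rV_cons0|have := h (lift ord0 i); rewrite rV_consS].
move=> [ha hv] i; case: (unliftP ord0 i) => [j ->|->].
  by rewrite rV_consS; exact: hv.
by rewrite rV_cons0.
Qed.

Section ricci.
Context (R : realType) (n : nat).
Implicit Types (P : set 'rV[R]_n) (f b : 'rV[R]_n -> \bar R).
Implicit Types (h l a : 'rV[R]_n -> R).

Local Notation dy := (lebesgue_rV R n).

Definition convex_body P : Prop :=
  [/\ compact P, convex_set (P : set (convex_lmodType 'rV[R]_n)) &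
      P° !=set0].

Definition affine_fun h : Prop :=
  exists (c : R) (u : 'rV[R]_n),
    forall y, h y = c + \sum_(i < n) u ord0 i * y ord0 i.

Definition is_ricci_affine P l : Prop :=
  affine_fun l /\
  forall h, affine_fun h -> - h 0 + \int[dy]_(y in P) (h y * l y) = 0.

(* [get] picks the element satisfying the predicate, here unique for a convex
   body P; same for the projection below when f is in L2 P. *)
Definition ricci_affine P : 'rV[R]_n -> R := get (is_ricci_affine P).

Local Open Scope ereal_scope.

(* A function P -> R u {oo} is the restriction to P of an f with values in
   \bar R; with 0 * +oo = 0 the cases t = 0 and t = 1 are harmless. *)
Definition convex_on P f : Prop :=
  (forall y, P y -> -oo < f y) /\
  forall (t : {i01 R}) (x y : 'rV[R]_n), P x -> P y ->
    f (t%:num *: x + (1 - t%:num) *: y)%R <=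
      t%:num%:E * f x + (1 - t%:num)%:E * f y.

Definition L2norm P f : \bar R := 'N[dy]_2%:E[f \_ P].

(* The sigma-algebra on 'rV[R]_n is not completed for dy: Lebesgue measurability
   is equality a.e. to a Borel function. Arbitrary boundary values of a convex
   function on P need not be Borel. *)
Definition L2 P f : Prop :=
  (exists2 g : 'rV[R]_n -> \bar R,
     measurable_fun P g & {ae dy, forall y, P y -> f y = g y}) /\
  L2norm P f < +oo.

Definition C2 P f : Prop := convex_on P f /\ L2 P f.

Definition D_NA P f : \bar R :=
  - f 0%R + \int[dy]_(y in P) (f y * (ricci_affine P y)%:E).

Definition is_affine_proj P f (p : 'rV[R]_n -> R) : Prop :=
  affine_fun p /\
  forall h, affine_fun h ->
    \int[dy]_(y in P) ((f y - (p y)%:E) * (h y)%:E) = 0.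

Definition affine_proj P f : 'rV[R]_n -> R := get (is_affine_proj P f).

Definition W_ell P f : R :=
  let N := L2norm P (fun y => f y - (affine_proj P f y)%:E) in
  if N == 0 then 0%R else (fine (D_NA P f) / fine N)%R.

Definition is_normalized_minimizer P f : Prop :=
  [/\ C2 P f,
      forall g, C2 P g -> (W_ell P f <= W_ell P g)%R,
      affine_proj P f = cst 0%R &
      \int[dy]_(y in P) (f y ^+ 2) = f 0%R].

Definition frakB P b : Prop :=
  [/\ {ae dy, forall y, P y -> 0 <= b y},
      L2 P b,
      \int[dy]_(y in P) b y = 1 &
      forall i : 'I_n, \int[dy]_(y in P) ((y ord0 i)%:E * b y) = 0].

Definition is_unique_min_norm P b : Prop :=
  [/\ frakB P b,
      forall c, frakB P c -> L2norm P b <= L2norm P c &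
      forall c, frakB P c -> (forall d, frakB P d -> L2norm P c <= L2norm P d) ->
        {ae dy, forall y, P y -> c y = b y}].

Local Close Scope ereal_scope.

Definition is_normalized_positive_part P a : Prop :=
  [/\ affine_fun a,
      \int[dy]_(y in P `&` [set y | 0 < a y]) a y = 1 &
      forall i : 'I_n,
        \int[dy]_(y in P `&` [set y | 0 < a y]) (y ord0 i * a y) = 0].

End ricci.

(* Main.v *)
Require Import Defs.
From mathcomp Require Import all_boot all_order all_algebra.
From mathcomp Require Import all_classical all_reals all_analysis.
From mathcomp Require Import measurable_realfun.
From mathcomp Require Import ring lra.

Set Implicit Arguments.
Unset Strict Implicit.
Unset Printing Implicit Defensive.
Import Order.TTheory GRing.Theory Num.Theory.
Import numFieldNormedType.Exports.
Local Open Scope classical_set_scope.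
Local Open Scope ring_scope.

(** Write [<u, v>] for the inner product of L2(P), [l] for the Ricci affine
    function and [b = f + l]. Every affine [h] satisfies [<h, l> = h(0)], and
    [<f, h> = 0] because the affine projection of [f] vanishes; with
    [<f, f> = f(0)] this gives [W(f) = - |f|], [<h, b> = h(0)] and
    [<b, b> = b(0)].

    Minimality of [W] at [f], tested on [f + t g] with [t] tending to [0], is
    the linear inequality

      [<g, b> >= g(0)] for every convex square-integrable [g]

    ([minimizer_first_variation]), with equality for [g = b]. It is used for
    three kinds of [g].
    - [g = max(0, b)]: from [<b, b> = b(0) <= g(0) <= <g, b>] the negative part
      of [b] vanishes ([optimal_ae_ge0]).
    - [g = max(0, a)], with [a] affine, [a <= b] and [a(0) = b(0)]: then
      [<b - g, b> <= 0] with both factors nonnegative, so [b = g] where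
      [b > 0], while [0 <= g <= b] forces [g = 0] where [b = 0]. Hence
      [b = max(0, a)] ([optimal_ae_pospart]). The function [a] is a subgradient
      of [b] at [0] ([exists_affine_support]).
    - [g = c], a convex density of mass [1] and barycentre [0]: this is the
      comparison [c(0) <= <c, b>] of [optimal_le_convex].

    For a density [c] of mass [1] and barycentre [0], Jensen's inequality for
    [max(0, a)] reduces to [<c, max(0, a)> >= <c, a> = a(0)], and
    [a(0) = <max(0, a), a> = <b, b>]. Thus [<b, b> <= <c, b>], which makes [b]
    the unique density of minimal norm since
    [|c - b|^2 = |c|^2 - 2 <c, b> + |b|^2 <= |c|^2 - |b|^2]
    ([min_norm_criterion]). For convex [c] it also gives
    [|c|^2 >= 2 <c, b> - |b|^2 >= <c, b> >= c(0)]. The affine function [a] is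
    unique because any competitor [a'] makes [max(0, a')] a density of minimal
    norm, hence equal to [max(0, a)], and both are positive near [0]. When
    [l >= 0], the same criterion applies to [l], as [<c, l> = l(0) = <l, l>].

    Two passages between null sets and points remain. Members of L2(P) are only
    almost everywhere equal to Borel functions, so each is replaced by a real
    Borel representative ([represents]). Conversely a convex function which is
    almost everywhere bounded below by an affine function, or above by a
    continuous one, is so at every point of [P], respectively of its interior
    ([ae_ge_affine], [ae_le_continuous]): convexity compares the value at a
    point with values at affine images of a moving point, and that moving point
    can be chosen so that these images avoid a given null set
    ([exists_generic_point]). *)

(** * Lebesgue measure on row vectors *)

Section euclidean_measure.
Context (R : realType).
Local Notation mu n := (lebesgue_rV R n).

Lemma measurable_rV_preimage n (A : 'I_n -> set R) :
  (forall i, measurable (A i)) ->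
  measurable [set x : 'rV[R]_n | forall i, A i (x ord0 i)].
Proof.
move=> mA.
have -> : [set x : 'rV[R]_n | forall i, A i (x ord0 i)] =
    \bigcap_(i in [set: 'I_n]) [set x | A i (x ord0 i)].
  by apply/seteqP; split=> [x h i _|x h i]; exact: h.
apply: fin_bigcap_measurable => // i _.
rewrite -[X in measurable X]setTI.
exact: (measurable_rV_coord (T := R) i measurableT (mA _)).
Qed.

Lemma ball_rVE n (x : 'rV[R]_n) (e : R) : 0 < e ->
  ball x e = [set y | forall i, ball (x ord0 i) e (y ord0 i)].
Proof.
move=> e0; apply/seteqP; split=> [y [_ h] i|y h]; first exact: h.
by split=> // i j; rewrite (ord1 i).
Qed.

Lemma measurable_rV_ball n (x : 'rV[R]_n) (e : R) : 0 < e ->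
  measurable (ball x e).
Proof.
move=> e0; rewrite ball_rVE//.
apply: (@measurable_rV_preimage _ (fun i => ball (x ord0 i) e)) => i.
exact: measurable_ball.
Qed.

(** The measurable structure is generated by the coordinates: an open set is the
    union of the countably many balls with rational centre and radius
    [1 / k.+1] which it contains. *)
Lemma open_measurable_rV n (U : set 'rV[R]_n) : open U -> measurable U.
Proof.
move=> oU.
pose r (p : 'rV[rat]_n * nat) : 'rV[R]_n := \row_i ratr (p.1 ord0 i).
pose B p := ball (r p) (p.2.+1%:R^-1 : R).
pose F p := if `[< B p `<=` U >] then B p else set0.
have -> : U = \bigcup_p F p.
  apply/seteqP; split=> [x Ux|x [p _]]; last first.
    by rewrite /F; case: asboolP => // pU; exact: pU.
  have /nbhs_ballP[e /= e0 eU] : nbhs x U by exact: open_nbhs_nbhs.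
  have [k ke] : exists k : nat, (k.+1%:R^-1 : R) < e / 2.
    have /archi_boundP : 0 <= (e / 2)^-1 by rewrite invr_ge0 ltW// divr_gt0.
    set k := Num.bound _ => hk; exists k.
    rewrite -[ltRHS]invrK ltf_pV2 ?posrE ?invr_gt0 ?divr_gt0//.
    by apply: lt_le_trans hk _; rewrite ler_nat.
  have k0 : 0 < (k.+1%:R^-1 : R) by rewrite invr_gt0.
  have /choice[q hq] : forall i : 'I_n, exists q : rat,
      ball (x ord0 i) (k.+1%:R^-1 : R) (ratr q).
    move=> i; have : x ord0 i - k.+1%:R^-1 < x ord0 i + k.+1%:R^-1.
      by rewrite ltrBlDr -addrA ltrDl addr_gt0.
    move=> /rat_in_itvoo[q]; rewrite in_itv/= => /andP[q1 q2]; exists q.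
    by rewrite /ball/= ltr_distlC q1.
  have xB : B (\row_i q i, k) x.
    by rewrite /B ball_rVE// => i /=; rewrite !mxE; apply: ball_sym; exact: hq.
  exists (\row_i q i, k) => //; rewrite /F; case: asboolP => // -[] y yB.
  apply: eU; rewrite [e]splitr; apply: ball_triangle.
    by apply: ball_sym; apply: le_ball xB; exact/ltW.
  by apply: le_ball yB; exact/ltW.
have cI : countable [set: ('rV[rat]_n * nat)%type] by exact: countableP.
apply: (countable_bigcupT_measurable cI) => p.
rewrite /F; case: asboolP => // _; apply: measurable_rV_ball.
by rewrite invr_gt0.
Qed.

Lemma closed_measurable_rV n (A : set 'rV[R]_n) : closed A -> measurable A.
Proof.
move=> cA; rewrite -[A]setCK; apply: measurableC; apply: open_measurable_rV.
by rewrite openC.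
Qed.

Lemma lebesgue_rV_ball n (x : 'rV[R]_n) (e : R) : 0 < e ->
  mu n (ball x e) = (\prod_(i < n) (e *+ 2))%:E.
Proof.
move=> e0; rewrite ball_rVE//.
have mB i : measurable (ball (x ord0 i) e) by exact: measurable_ball.
rewrite (lebesgue_rV_box mB).
rewrite -prodEFin; apply: eq_bigr => i _.
by rewrite lebesgue_measure_ball// ltW.
Qed.

Lemma lebesgue_rV_open_gt0 n (U : set 'rV[R]_n) :
  open U -> U !=set0 -> (0 < mu n U)%E.
Proof.
move=> oU [x Ux].
have /nbhs_ballP[e /= e0 eU] : nbhs x U by exact: open_nbhs_nbhs.
apply: (@lt_le_trans _ _ (mu n (ball x e))).
  rewrite lebesgue_rV_ball// lte_fin; apply: prodr_gt0 => i _.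
  by rewrite pmulrn_rgt0.
apply: le_measure => //; rewrite inE; first exact: measurable_rV_ball.
exact: open_measurable_rV.
Qed.

Lemma compact_measurable_rV n (A : set 'rV[R]_n) : compact A -> measurable A.
Proof.
move=> cA; apply: closed_measurable_rV; apply: compact_closed cA.
exact: (@norm_hausdorff R 'rV[R]_n).
Qed.

Lemma lebesgue_rV_compact_lty n (A : set 'rV[R]_n) :
  compact A -> (mu n A < +oo)%E.
Proof.
move=> cA; have [M [_ MA]] := compact_bounded cA.
have M1 : M < `|M| + 1 by rewrite (le_lt_trans (ler_norm _))// ltrDl.
have M0 : 0 < `|M| + 2 by rewrite ltr_pwDr.
apply: (@le_lt_trans _ _ (mu n (ball 0 (`|M| + 2)))); last first.
  by rewrite lebesgue_rV_ball// ltry.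
apply: le_measure; rewrite ?inE.
- exact: compact_measurable_rV.
- exact: measurable_rV_ball.
- move=> x /(MA _ M1) /= xM; rewrite mx_norm_ball /ball_/= sub0r normrN.
  by rewrite (le_lt_trans xM)// ltrD2l ltr1n.
Qed.

Lemma scaled_pushforward d1 d2 (T1 : measurableType d1) (T2 : measurableType d2)
    (m1 : {measure set T1 -> \bar R}) (f : T1 -> T2) (c : R) :
  measurable_fun setT f -> 0 <= c ->
  exists m : {measure set T2 -> \bar R},
    forall A, m A = (c%:E * m1 (f @^-1` A))%E.
Proof.
move=> mf c0.
by exists (mscale (NngNum c0)
  (measure_function_pushforward__canonical__measure_function_Measure m1 mf)).
Qed.

(** By uniqueness of Lebesgue measure it is enough to compare half-open
    intervals, whose preimages are closed on the other side when [s < 0]. *)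
Lemma lebesgue_measure_affine (s v : R) (A : set (measurableTypeR R)) :
  s != 0 -> measurable A ->
  (`|s|%:E * lebesgue_measure ((fun x : R => s * x + v)%R @^-1` A))%E =
  lebesgue_measure A.
Proof.
move=> s0 mA.
pose f (x : measurableTypeR R) : measurableTypeR R := s * x + v.
have mf : measurable_fun setT f.
  by apply: measurable_funD => //; exact: measurable_funM.
have [m mE] := scaled_pushforward lebesgue_measure mf (normr_ge0 s).
apply/esym; rewrite (lebesgue_measure_unique (mu := m))// => _ [[a b]] _ <-.
rewrite mE /=.
case: (ltrgt0P s) s0 => // s0 _.
- rewrite (_ : _ @^-1` _ = `](a - v) / s, (b - v) / s]%classic); last first.
    apply/seteqP; split=> x /=; rewrite !in_itv/= /f.
      by rewrite ltr_pdivrMr// ler_pdivlMr// [x * s]mulrC ltrBlDr lerBrDr.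
    by rewrite ltr_pdivrMr// ler_pdivlMr// [x * s]mulrC ltrBlDr lerBrDr.
  rewrite !lebesgue_measure_itv/= !lte_fin ltr_pM2r ?invr_gt0// ltrD2r.
  case: ifPn => _; last by rewrite mule0.
  by rewrite -!EFinD -EFinM; congr EFin; field; rewrite gt_eqF.
- rewrite (_ : _ @^-1` _ = `[(b - v) / s, (a - v) / s[%classic); last first.
    apply/seteqP; split=> x /=; rewrite !in_itv/= /f.
      by rewrite ltr_ndivlMr// ler_ndivrMr// [x * s]mulrC ltrBlDr lerBrDr andbC.
    by rewrite ltr_ndivlMr// ler_ndivrMr// [x * s]mulrC ltrBlDr lerBrDr andbC.
  rewrite !lebesgue_measure_itv/= !lte_fin ltr_nM2r ?invr_lt0// ltrD2r.
  case: ifPn => _; last by rewrite mule0.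
  by rewrite -!EFinD -EFinM; congr EFin; field; rewrite lt_eqF.
Qed.

Lemma affine_entry n (s : R) (x v : 'rV[R]_n) i :
  (s *: x + v) ord0 i = s * x ord0 i + v ord0 i.
Proof. by rewrite !mxE. Qed.

Lemma measurable_rV_affine n (s : R) (v : 'rV[R]_n) :
  measurable_fun setT (fun x : 'rV[R]_n => s *: x + v).
Proof.
apply: measurable_fun_rV => i.
under eq_fun do rewrite affine_entry.
apply: measurable_funD => //; apply: measurable_funM => //.
exact: measurable_rV_coord.
Qed.

(** The map acts on the first coordinate and on the remaining ones separately,
    so the claim follows by induction from uniqueness of product measures. *)
Lemma lebesgue_rV_affine n (s : R) (v : 'rV[R]_n) (A : set 'rV[R]_n) :
  s != 0 -> measurable A ->
  ((`|s| ^+ n)%:E * mu n ((fun x => s *: x + v)%R @^-1` A))%E = mu n A.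
Proof.
move=> s0; elim: n v A => [v A mA|n IH v A mA].
  rewrite expr0 mul1e (_ : _ @^-1` A = A)//; apply/seteqP; split=> x /=;
    by rewrite [s *: x + v]thinmx0 [x]thinmx0.
pose w : 'rV[R]_n := \row_j v ord0 (lift ord0 j).
pose g (x : measurableTypeR R) : measurableTypeR R := s * x + v ord0 ord0.
pose G (p : measurableTypeR R * 'rV[R]_n) := (g p.1, s *: p.2 + w).
have GE p : s *: rV_cons p + v = rV_cons (G p).
  apply/rowP => i; rewrite affine_entry.
  case: (unliftP ord0 i) => [j ->|->]; last by rewrite !rV_cons0.
  by rewrite !rV_consS affine_entry mxE.
have mg : measurable_fun setT g.
  by apply: measurable_funD => //; exact: measurable_funM.
have mh : measurable_fun setT (fun x : 'rV[R]_n => s *: x + w).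
  exact: measurable_rV_affine.
have mG : measurable_fun setT G.
  apply/measurable_fun_pair; first exact: measurableT_comp.
  exact: (measurableT_comp mh).
have [m mE] := scaled_pushforward (lebesgue_measure \x mu n)%E mG
  (exprn_ge0 n.+1 (normr_ge0 s)).
rewrite /= /lebesgue_rVS /pushforward.
transitivity (m (@rV_cons R n @^-1` A)).
  rewrite mE; congr (_ * _)%E; congr (product_measure1 _ _ _).
  by apply/seteqP; split=> p; rewrite /= GE.
apply/esym/product_measure_unique => [B C mB mC|]; last first.
  by rewrite -[X in measurable X]setTI; exact: measurable_rV_cons.
rewrite mE (_ : G @^-1` _ =
    (g @^-1` B) `*` ((fun x => s *: x + w) @^-1` C)); last by [].
have mB' : measurable (g @^-1` B).
  by rewrite -[X in measurable X]setTI; exact: mg.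
have mC' : measurable ((fun x => s *: x + w) @^-1` C).
  by rewrite -[X in measurable X]setTI; exact: mh.
transitivity ((`|s| ^+ n.+1)%:E * (lebesgue_measure (g @^-1` B) *
    mu n ((fun x => s *: x + w)%R @^-1` C)))%E.
  congr (_ * _)%E.
  exact: (product_measure1E lebesgue_measure (mu n) mB' mC').
rewrite exprS EFinM muleACA; congr (_ * _)%E; last exact: IH.
exact: lebesgue_measure_affine.
Qed.

(** The points [w] to be avoided form a countable union of preimages of [N]
    under invertible affine maps; it is negligible, whereas a nonempty open set
    is not. *)
Lemma exists_generic_point n (U N : set 'rV[R]_n) (s : nat -> R)
    (v : nat -> 'rV[R]_n) :
  open U -> U !=set0 -> (mu n).-negligible N -> (forall k, s k != 0) ->
  exists2 w, U w & forall k, ~ N (s k *: w + v k).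
Proof.
move=> oU U0 [M [mM M0 NM]] s0.
pose F k := (fun x : 'rV[R]_n => s k *: x + v k) @^-1` M.
have F0 : (mu n).-negligible (\bigcup_k F k).
  apply: negligible_bigcup => k.
  have mF : measurable (F k).
    rewrite -[X in measurable X]setTI.
    by apply: measurable_rV_affine => //.
  exists (F k); split=> //.
  have := lebesgue_rV_affine (v k) (s0 k) mM; rewrite M0 => /eqP.
  rewrite mule_eq0 => /orP[|/eqP//].
  by rewrite eqe expf_eq0 normr_eq0 (negbTE (s0 k)) andbF.
apply: contrapT => now.
have : (mu n).-negligible U.
  apply: negligibleS F0 => w Uw; apply: contrapT => nw; apply: now.
  exists w => // k /NM Mk; apply: nw; by exists k.
move=> /(measure_negligible (open_measurable_rV oU)) U00.
by have := lebesgue_rV_open_gt0 oU U0; rewrite U00 ltxx.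
Qed.

(** * Convex bodies *)

Section convex_body.
Variables (n : nat) (P : set 'rV[R]_n).
Hypothesis P_body : convex_body P.

Lemma convex_body_measurable : measurable P.
Proof. by have [cP _ _] := P_body; exact: compact_measurable_rV. Qed.

Lemma convex_body_lty : (mu n P < +oo)%E.
Proof. by have [cP _ _] := P_body; exact: lebesgue_rV_compact_lty. Qed.

Lemma convex_bodyP (t : R) x y : 0 <= t -> t <= 1 -> P x -> P y ->
  P (t *: x + (1 - t) *: y).
Proof.
move=> t0 t1 Px Py; have [_ cP _] := P_body.
by have := cP x y (Itv01 t0 t1); rewrite !inE; apply.
Qed.

Lemma convex_body_interior (t : R) x y : 0 < t -> t <= 1 -> P° x -> P y ->
  P° (t *: x + (1 - t) *: y).
Proof.
move=> t0 t1 /nbhs_ballP[e /= e0 eP] Py.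
apply/nbhs_ballP; exists (t * e) => /=; first exact: mulr_gt0.
move=> z; rewrite mx_norm_ball /ball_/= => zte.
have -> : z = t *: (x + t^-1 *: (z - (t *: x + (1 - t) *: y))) + (1 - t) *: y.
  rewrite scalerDr scalerA mulfV ?gt_eqF// scale1r.
  by rewrite addrAC addrC subrK.
apply: convex_bodyP => //; first exact: ltW.
apply: eP; rewrite mx_norm_ball /ball_/= opprD addrA subrr sub0r normrN.
by rewrite normrZ gtr0_norm ?invr_gt0// ltr_pdivrMl// distrC.
Qed.

(** For [t < 1] the set [t P] lies in the interior of [P], which therefore has
    measure at least [t ^ n] times that of [P]; let [t] tend to [1]. *)
Lemma convex_body_boundary_null : P° 0 -> mu n (P `\` P°) = 0%E.
Proof.
move=> P0.
have mP := convex_body_measurable.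
have mPi : measurable P° by apply: open_measurable_rV; exact: open_interior.
have Poo := convex_body_lty.
have Pioo : (mu n P° < +oo)%E.
  apply: le_lt_trans Poo; apply: le_measure; rewrite ?inE//.
  exact: interior_subset.
rewrite measureD// setIidr; last exact: interior_subset.
apply/eqP; rewrite sube_eq ?add0e//; last by rewrite ge0_fin_numE.
rewrite eq_le; apply/andP; split; last first.
  by apply: le_measure; rewrite ?inE//; exact: interior_subset.
have shrink t : 0 < t -> t < 1 -> ((t ^+ n)%:E * mu n P <= mu n P°)%E.
  move=> t0 t1.
  have tN0 : t^-1 != 0 by rewrite invr_eq0 gt_eqF.
  rewrite -(lebesgue_rV_affine 0 tN0 mP) muleA -EFinM.
  rewrite gtr0_norm ?invr_gt0// exprVn mulfV ?mul1e ?expf_neq0 ?gt_eqF//.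
  apply: le_measure; rewrite ?inE//.
    rewrite -[X in measurable X]setTI.
    by apply: measurable_rV_affine.
  move=> x /=; rewrite addr0 => Px.
  have := @convex_body_interior (1 - t) 0 _ _ _ P0 Px.
  rewrite scaler0 add0r subKr scalerA mulfV ?gt_eqF// scale1r.
  by apply; rewrite ?subr_gt0// gerBl ltW.
have bernoulli (e : R) : 0 <= e -> e <= 1 -> 1 - n%:R * e <= (1 - e) ^+ n.
  move=> e0 e1; elim: n => [|k IH]; first by rewrite mul0r subr0 expr0.
  rewrite exprSr; apply: le_trans (ler_wpM2r _ IH); last by rewrite subr_ge0.
  rewrite -natr1; have : 0 <= k%:R * e ^+ 2 by rewrite mulr_ge0 ?sqr_ge0.
  by rewrite expr2; lra.
have p0 : (0 <= mu n P)%E by exact: measure_ge0.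
have [p pE] : exists p, mu n P = p%:E.
  by exists (fine (mu n P)); rewrite fineK// ge0_fin_numE.
have [q qE] : exists q, mu n P° = q%:E.
  by exists (fine (mu n P°)); rewrite fineK// ge0_fin_numE// measure_ge0.
move: p0 shrink; rewrite pE qE => + shrink; rewrite lee_fin => p0'.
suff : (p%:E <= q%:E)%E by rewrite -pE -qE.
rewrite lee_fin; apply/ler_addgt0Pr => d d0.
(* with [t = 1 - e] the loss [n * e * p] is at most [d] *)
pose e := Num.min (1 / 2) (d / (n%:R * p + 1)).
have np : 0 < n%:R * p + 1 by rewrite ltr_wpDl// mulr_ge0.
have e0 : 0 < e by rewrite lt_min divr_gt0//= divr_gt0.
have e1 : e <= 1 / 2 by rewrite ge_min lexx.
have e2 : e * (n%:R * p + 1) <= d by rewrite -ler_pdivlMr// ge_min lexx orbT.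
have : (1 - n%:R * e) * p <= q.
  apply: le_trans (ler_wpM2r p0' (bernoulli _ (ltW e0) _)) _; first by lra.
  have /shrink : 0 < 1 - e by lra.
  by rewrite -EFinM lee_fin; apply; lra.
by nra.
Qed.

End convex_body.

End euclidean_measure.

(** * Square-integrable functions *)

Section ae_equal_integrals.
Context d (T : measurableType d) (R : realType).
Variable mu : {measure set T -> \bar R}.
Local Open Scope ereal_scope.
Import HBNNSimple.

Let le_ae_integral (f g : T -> \bar R) (N : set T) :
  (forall x, 0 <= f x) -> (forall x, 0 <= g x) ->
  measurable N -> mu N = 0 -> (forall x, ~ N x -> f x = g x) ->
  \int[mu]_x f x <= \int[mu]_x g x.
Proof.
move=> f0 g0 mN N0 fg; rewrite !ge0_integralTE//.
apply: ge_ereal_sup => _ [h /= hf <-].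
have mNC := measurableC mN.
apply: le_ereal_sup_tmp; exists (sintegral mu (proj_nnsfun h mNC)).
  exists (proj_nnsfun h mNC) => //= x; rewrite mindicE.
  have [|_] := boolP (x \in ~` N); last by rewrite mulr0.
  by rewrite inE => Nx; rewrite mulr1 -fg.
rewrite -!integralT_nnsfun.
rewrite (ae_eq_integral (fun x => (proj_nnsfun h mNC x)%:E))//.
- exact/measurable_EFinP.
- exact/measurable_EFinP.
exists N; split=> // x /= /not_implyP[_]; apply: contra_notP => Nx.
by rewrite mindicE mem_set// mulr1.
Qed.

(** Members of [L2 P] are only almost everywhere equal to Borel functions, and
    this transfers their integrals to Borel representatives. The integral of a
    nonnegative function is the supremum of the integrals of the simple
    functions below it, and cutting such a simple function off on a null set
    does not change its integral. *)
Lemma eq_ae_integral (D : set T) (f g : T -> \bar R) :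
  {ae mu, forall x, D x -> f x = g x} ->
  \int[mu]_(x in D) f x = \int[mu]_(x in D) g x.
Proof.
move=> [N [mN N0 fgN]].
have fgD x : ~ N x -> (f \_ D) x = (g \_ D) x.
  rewrite /patch => Nx; case: ifPn => // /set_mem Dx.
  by apply: contrapT => fgx; apply: Nx; apply: fgN => /(_ Dx).
rewrite integral_mkcond [RHS]integral_mkcond integralE [RHS]integralE.
congr (_ - _); apply/eqP; rewrite eq_le; apply/andP; split;
  apply: (le_ae_integral _ _ mN N0) => // x Nx;
  by rewrite ?funeposE ?funenegE fgD.
Qed.

End ae_equal_integrals.

Section square_integrable.
Context d (T : measurableType d) (R : realType).
Variables (mu : {measure set T -> \bar R}) (D : set T).
Hypothesis mD : measurable D.
Implicit Types F G H : T -> R.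

Definition sq_integrable F :=
  measurable_fun D F /\ mu.-integrable D (fun x => (F x * F x)%:E).

Definition L2dot F G := \int[mu]_(x in D) (F x * G x).

Local Notation dot := L2dot.

Lemma sq_integrable_mul F G : sq_integrable F -> sq_integrable G ->
  mu.-integrable D (fun x => (F x * G x)%:E).
Proof.
move=> [mF iF] [mG iG].
apply: (le_integrable mD (g := fun x => ((F x * F x)%:E + (G x * G x)%:E)%E)).
- by apply/measurable_EFinP/measurable_funM.
- move=> x _; rewrite -EFinD !abse_EFin lee_fin.
  rewrite [leRHS]ger0_norm ?addr_ge0 -?expr2 ?sqr_ge0// normrM.
  have := sqr_ge0 (`|F x| - `|G x|).
  rewrite sqrrB -!normrX !(ger0_norm (sqr_ge0 _)) !expr2 mulr2n => h.
  by have : 0 <= `|F x| * `|G x| by []; lra.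
- exact: integrableD.
Qed.

Lemma le_sq_integrable F G : measurable_fun D G ->
  (forall x, D x -> `|G x| <= `|F x|) -> sq_integrable F -> sq_integrable G.
Proof.
move=> mG GF [mF iF]; split=> //.
apply: (le_integrable mD _ _ iF).
- by apply/measurable_EFinP/measurable_funM.
- move=> x Dx; rewrite !abse_EFin lee_fin !normrM.
  by apply: ler_pM => //; exact: GF.
Qed.

Lemma sq_integrableD F G : sq_integrable F -> sq_integrable G ->
  sq_integrable (fun x => F x + G x).
Proof.
move=> [mF iF] [mG iG]; split; first exact: measurable_funD.
have iFG := sq_integrable_mul (conj mF iF) (conj mG iG).
apply: (eq_integrable mD (fun x =>
    ((F x * F x)%:E + ((F x * G x)%:E + ((F x * G x)%:E + (G x * G x)%:E)))%E)).
  by move=> x _; rewrite -!EFinD; congr EFin; ring.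
by do 3 (apply: integrableD => //).
Qed.

Lemma sq_integrableZ c F : sq_integrable F -> sq_integrable (fun x => c * F x).
Proof.
move=> [mF iF]; split; first exact: measurable_funM.
apply: (eq_integrable mD (fun x => ((c * c)%:E * (F x * F x)%:E)%E)).
  by move=> x _; rewrite -!EFinM; congr EFin; ring.
exact: integrableZl.
Qed.

Lemma sq_integrableB F G : sq_integrable F -> sq_integrable G ->
  sq_integrable (fun x => F x - G x).
Proof.
move=> iF iG; have -> : (fun x => F x - G x) = (fun x => F x + -1 * G x).
  by apply/funext => x; ring.
exact/sq_integrableD/sq_integrableZ.
Qed.

Lemma sq_integrable_max F G : sq_integrable F -> sq_integrable G ->
  sq_integrable (fun x => Num.max (F x) (G x)).
Proof.
move=> iF iG.
have iH : sq_integrable (fun x => `|F x| + `|G x|).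
  apply: sq_integrableD.
    apply: (le_sq_integrable _ _ iF); last by move=> x _; rewrite normr_id.
    by apply: measurableT_comp => //; case: iF.
  apply: (le_sq_integrable _ _ iG); last by move=> x _; rewrite normr_id.
  by apply: measurableT_comp => //; case: iG.
apply: (le_sq_integrable _ _ iH).
  by apply: measurable_maxr; [case: iF|case: iG].
move=> x _; rewrite [leRHS]ger0_norm ?addr_ge0//.
by case: (leP (F x) (G x)) => _; rewrite ?lerDl ?lerDr.
Qed.

Lemma dotC F G : dot F G = dot G F.
Proof. by apply: eq_Rintegral => x _; rewrite mulrC. Qed.

Lemma dotDl F G H : sq_integrable F -> sq_integrable G -> sq_integrable H ->
  dot (fun x => F x + G x) H = dot F H + dot G H.
Proof.
move=> iF iG iH; rewrite -RintegralD//; try exact: sq_integrable_mul.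
by apply: eq_Rintegral => x _; rewrite mulrDl.
Qed.

Lemma dotZl c F H : sq_integrable F -> sq_integrable H ->
  dot (fun x => c * F x) H = c * dot F H.
Proof.
move=> iF iH; rewrite -RintegralZl//; try exact: sq_integrable_mul.
by apply: eq_Rintegral => x _; rewrite mulrA.
Qed.

Lemma dot_suml I (s : seq I) (F : I -> T -> R) H :
  (forall i, sq_integrable (F i)) -> sq_integrable H ->
  sq_integrable (fun x => \sum_(i <- s) F i x) /\
  dot (fun x => \sum_(i <- s) F i x) H = \sum_(i <- s) dot (F i) H.
Proof.
move=> iF iH; elim: s => [|i s [is0 IH]].
  have -> : (fun x => \sum_(i <- [::]) F i x) = (fun=> 0).
    by apply/funext => x; rewrite big_nil.
  rewrite big_nil; split.
    by split=> //; under eq_fun do rewrite mul0r; exact: integrable0.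
  rewrite /L2dot; under eq_Rintegral do rewrite mul0r.
  by rewrite Rintegral_cst// mul0r.
rewrite big_cons -IH -dotDl//; split.
  by under eq_fun do rewrite big_cons; exact: sq_integrableD.
by apply: eq_Rintegral => x _; rewrite big_cons.
Qed.

Lemma dotBl F G H : sq_integrable F -> sq_integrable G -> sq_integrable H ->
  dot (fun x => F x - G x) H = dot F H - dot G H.
Proof.
move=> iF iG iH; rewrite -RintegralB//; try exact: sq_integrable_mul.
by apply: eq_Rintegral => x _; rewrite mulrBl.
Qed.

Lemma dot_ge0 F : 0 <= dot F F.
Proof. by apply: Rintegral_ge0 => x _; rewrite -expr2 sqr_ge0. Qed.

Lemma EFin_dot F G : sq_integrable F -> sq_integrable G ->
  (\int[mu]_(x in D) (F x * G x)%:E)%E = (dot F G)%:E.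
Proof.
move=> iF iG; rewrite /L2dot /Rintegral fineK//.
exact: integrable_fin_num (sq_integrable_mul iF iG).
Qed.

Lemma dot_sqrB F G : sq_integrable F -> sq_integrable G ->
  dot (fun x => F x - G x) (fun x => F x - G x) =
  dot F F - 2 * dot F G + dot G G.
Proof.
move=> iF iG; have iFG := sq_integrableB iF iG.
rewrite dotBl// dotC [dot G _]dotC !dotBl// (dotC G F).
by ring.
Qed.

Lemma dot_sqrD F G : sq_integrable F -> sq_integrable G ->
  dot (fun x => F x + G x) (fun x => F x + G x) =
  dot F F + 2 * dot F G + dot G G.
Proof.
move=> iF iG; have iFG := sq_integrableD iF iG.
rewrite dotDl// dotC [dot G _]dotC !dotDl// (dotC G F).
by ring.
Qed.

Lemma eq_dot_ae F G H : {ae mu, forall x, D x -> F x = G x} ->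
  dot F H = dot G H.
Proof.
move=> FG; congr fine; apply: eq_ae_integral.
by apply: filterS FG => x FG /FG ->.
Qed.

Lemma le_dot F G H : sq_integrable F -> sq_integrable G -> sq_integrable H ->
  {ae mu, forall x, D x -> 0 <= (G x - F x) * H x} -> dot F H <= dot G H.
Proof.
move=> iF iG iH GFH; rewrite -subr_ge0 -dotBl//.
have -> : dot (fun x => G x - F x) H =
    \int[mu]_(x in D) Num.max 0 ((G x - F x) * H x).
  congr fine; apply: eq_ae_integral; apply: filterS GFH => x h /h {}h.
  by rewrite max_r.
by apply: Rintegral_ge0 => x _; rewrite le_max lexx.
Qed.

(** An integral of a nonnegative function vanishes only if the function does
    almost everywhere; this is what turns the variational inequality into
    pointwise information. *)
Lemma dot_ge0_eq0 F G : sq_integrable F -> sq_integrable G ->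
  {ae mu, forall x, D x -> 0 <= F x * G x} -> dot F G <= 0 ->
  {ae mu, forall x, D x -> F x * G x = 0}.
Proof.
move=> iF iG FG0 dFG.
have iFG := sq_integrable_mul iF iG.
have mFG : measurable_fun D (fun x => (F x * G x)%:E).
  exact: measurable_int iFG.
have : (\int[mu]_(x in D) `|(F x * G x)%:E| = 0)%E.
  rewrite (eq_ae_integral (g := fun x => (F x * G x)%:E)); last first.
    by apply: filterS FG0 => x h /h {}h; rewrite abse_EFin ger0_norm.
  rewrite EFin_dot//; congr EFin; apply/eqP; rewrite eq_le dFG/=.
  have := @le_dot (fun=> 0) F G.
  rewrite [dot (fun=> 0) G](_ : _ = 0); last first.
    rewrite /L2dot; under eq_Rintegral do rewrite mul0r.
    by rewrite Rintegral_cst// mul0r.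
  apply=> //.
    split=> //; under eq_fun do rewrite mul0r.
    exact: integrable0.
  by apply: filterS FG0 => x h /h; rewrite subr0.
move/(ae_eq_integral_abs mu mD mFG).
by apply: filterS => x h /h/= [].
Qed.

Lemma dot_eq0 F : sq_integrable F -> dot F F <= 0 ->
  {ae mu, forall x, D x -> F x = 0}.
Proof.
move=> iF FF; have := dot_ge0_eq0 iF iF _ FF.
have h : {ae mu, forall x, D x -> 0 <= F x * F x}.
  by apply: aeW => x _; rewrite -expr2 sqr_ge0.
move=> /(_ h); apply: filterS => x {}h /h /eqP.
by rewrite mulf_eq0 orbb => /eqP.
Qed.

End square_integrable.

Section representatives.
Context (R : realType) (n : nat) (P : set 'rV[R]_n).
Hypothesis mP : measurable P.
Local Notation mu := (lebesgue_rV R n).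
Local Notation sqint := (sq_integrable mu P).
Local Notation dot := (L2dot mu P).
Implicit Types (f : 'rV[R]_n -> \bar R) (F G h : 'rV[R]_n -> R).

(** Real Borel representatives bring the extended-valued functions into a space
    where sums and differences are unrestricted. *)
Definition represents f F :=
  sqint F /\ {ae mu, forall y, P y -> f y = (F y)%:E}.

Lemma L2norm_integral f :
  L2norm P f = ((\int[mu]_(y in P) (f y ^+ 2)) `^ 2^-1)%E.
Proof.
rewrite /L2norm unlock; congr (_ `^ _)%E; rewrite [RHS]integral_mkcond.
apply: eq_integral => y _; rewrite /patch; case: ifPn => _; last first.
  by rewrite abse0 poweR0r// pnatr_eq0.
case: (f y) => [r||] /=.
- by rewrite powR_mulrn// real_normK ?num_real// EFin_expe.
- by rewrite mulyy; case: ifP => //; rewrite pnatr_eq0.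
- by rewrite mulNyNy; case: ifP => //; rewrite pnatr_eq0.
Qed.

Lemma represents_integral_mul f F h : represents f F -> sqint h ->
  (\int[mu]_(y in P) (f y * (h y)%:E) = (dot F h)%:E)%E.
Proof.
move=> [iF fF] ih; rewrite -EFin_dot//; apply: eq_ae_integral.
by apply: filterS fF => y fF /fF ->; rewrite EFinM.
Qed.

Lemma represents_integral_sq f F : represents f F ->
  (\int[mu]_(y in P) (f y ^+ 2) = (dot F F)%:E)%E.
Proof.
move=> [iF fF]; rewrite -EFin_dot//; apply: eq_ae_integral.
by apply: filterS fF => y fF /fF ->; rewrite expe2 EFinM.
Qed.

Lemma represents_L2norm f F : represents f F ->
  (L2norm P f = (Num.sqrt (dot F F))%:E)%E.
Proof.
move=> rF; rewrite L2norm_integral (represents_integral_sq rF) poweR_EFin.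
by rewrite powR12_sqrt// dot_ge0.
Qed.

Lemma represents_L2 f F : represents f F -> L2 P f.
Proof.
move=> rF; split; last by rewrite (represents_L2norm rF) ltry.
have [[mF _] fF] := rF.
by exists (EFin \o F) => //; exact/measurable_EFinP.
Qed.

Lemma L2_represents f : L2 P f -> exists F, represents f F.
Proof.
move=> [[g mg fg] foo].
have ig : mu.-integrable P (fun y => (g y * g y)%E).
  apply/integrableP; split; first exact: emeasurable_funM.
  have -> : (\int[mu]_(y in P) `|g y * g y| = \int[mu]_(y in P) (f y ^+ 2))%E.
    apply: eq_ae_integral; apply: filterS fg => y fg /fg ->.
    rewrite expe2 gee0_abs//; case: (g y) => [r||].
    - by rewrite lee_fin -expr2 sqr_ge0.
    - by rewrite mulyy.
    - by rewrite mulNyNy.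
  move: foo; rewrite L2norm_integral ltey; apply: contraTT.
  rewrite -leNgt leye_eq => /eqP ->.
  by rewrite poweRyr// invr_eq0.
have gF : {ae mu, forall y, P y -> g y = (fine (g y))%:E}.
  apply: filterS (integrable_ae mP ig) => y h /h.
  by case: (g y) => [r _||] //; rewrite ?mulyy ?mulNyNy.
have mF : measurable_fun P (fine \o g) by exact: measurableT_comp.
exists (fine \o g); split; last first.
  by apply: filterS2 fg gF => y fg gF Py; rewrite fg// gF.
split=> //.
apply/integrableP; split; first by apply/measurable_EFinP/measurable_funM.
have /integrableP[_] := ig; apply: le_lt_trans.
rewrite le_eqVlt; apply/orP; left; apply/eqP.
apply: eq_ae_integral; apply: filterS gF => y gF /gF {}gF.
by rewrite gF -EFinM.
Qed.

Lemma representsD f g F G : represents f F -> represents g G ->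
  represents (fun y => f y + g y)%E (fun y => F y + G y).
Proof.
move=> [iF fF] [iG gG]; split; first exact: sq_integrableD.
by apply: filterS2 fF gG => y fF gG Py; rewrite fF// gG.
Qed.

Lemma representsZ c f F : represents f F ->
  represents (fun y => c%:E * f y)%E (fun y => c * F y).
Proof.
move=> [iF fF]; split; first exact: sq_integrableZ.
by apply: filterS fF => y fF Py; rewrite fF.
Qed.

Lemma represents_EFin F : sqint F -> represents (EFin \o F) F.
Proof. by move=> iF; split=> //; apply: aeW. Qed.

Lemma represents_max0 f F : represents f F ->
  represents (fun y => maxe 0%E (f y)) (fun y => Num.max 0 (F y)).
Proof.
move=> [iF fF]; split.
  apply: (sq_integrable_max mP _ iF); split=> //.
  by under eq_fun do rewrite mul0r; exact: integrable0.
by apply: filterS fF => y fF Py; rewrite fF// EFin_max.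
Qed.

End representatives.

(** * Affine functions *)

Section affine_functions.
Context (R : realType) (n : nat).
Implicit Types (h : 'rV[R]_n -> R) (x y : 'rV[R]_n).

Lemma affine_fun_conv h (t : R) x y : affine_fun h ->
  h (t *: x + (1 - t) *: y) = t * h x + (1 - t) * h y.
Proof.
move=> [c [u hE]]; rewrite !hE.
have -> : \sum_(i < n) u ord0 i * (t *: x + (1 - t) *: y) ord0 i =
    t * \sum_(i < n) u ord0 i * x ord0 i +
    (1 - t) * \sum_(i < n) u ord0 i * y ord0 i.
  rewrite !mulr_sumr -big_split; apply: eq_bigr => i _ /=.
  by rewrite !mxE; ring.
by ring.
Qed.

Lemma affine_funD h1 h2 : affine_fun h1 -> affine_fun h2 ->
  affine_fun (fun y => h1 y + h2 y).
Proof.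
move=> [c1 [u1 h1E]] [c2 [u2 h2E]]; exists (c1 + c2), (u1 + u2) => y.
rewrite h1E h2E addrACA -big_split; congr (_ + _); apply: eq_bigr => i _ /=.
by rewrite !mxE mulrDl.
Qed.

Lemma affine_funZ k h : affine_fun h -> affine_fun (fun y => k * h y).
Proof.
move=> [c [u hE]]; exists (k * c), (k *: u) => y.
rewrite hE mulrDr mulr_sumr; congr (_ + _); apply: eq_bigr => i _ /=.
by rewrite !mxE mulrA.
Qed.

Lemma affine_funB h1 h2 : affine_fun h1 -> affine_fun h2 ->
  affine_fun (fun y => h1 y - h2 y).
Proof.
move=> ah1 /(affine_funZ (-1)) ah2.
have -> : (fun y => h1 y - h2 y) = (fun y => h1 y + -1 * h2 y).
  by apply/funext => y; ring.
exact: affine_funD.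
Qed.

Lemma affine_fun_cst c : affine_fun (fun _ : 'rV[R]_n => c).
Proof.
by exists c, 0 => y; rewrite big1 ?addr0// => i _; rewrite mxE mul0r.
Qed.

Lemma affine_fun_coord (i : 'I_n) : affine_fun (fun y : 'rV[R]_n => y ord0 i).
Proof.
exists 0, (delta_mx ord0 i) => y; rewrite add0r (bigD1 i)//= big1 => [|j ji].
  by rewrite mxE !eqxx mul1r addr0.
by rewrite mxE eqxx (negbTE ji) mul0r.
Qed.

Lemma continuous_affine_fun h : affine_fun h -> continuous h.
Proof.
move=> [c [u /funext ->]].
have cu : continuous (fun z : 'rV[R]_n => \sum_(i < n) u ord0 i * z ord0 i).
  apply: (@continuous_big _ _ _ _ _ _ _ _
    (fun i (z : 'rV[R]_n) => u ord0 i * z ord0 i)) => [|i _ z].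
    exact: add_continuous.
  exact: (@cvgM _ _ (nbhs z) _ _ _ _ _ (cvg_cst (u ord0 i))
    (@coord_continuous _ _ _ _ _ z)).
by move=> y; exact: (@cvgD _ _ _ (nbhs y) _ _ _ _ _ (cvg_cst c) (cu y)).
Qed.

Lemma measurable_affine_fun h (D : set 'rV[R]_n) :
  affine_fun h -> measurable_fun D h.
Proof.
move=> [c [u /funext ->]]; apply: measurable_funTS.
apply: measurable_funD => //.
apply: (@measurable_sum _ _ _ _ _ _
  (fun i (y : 'rV[R]_n) => u ord0 i * y ord0 i)) => i.
by apply: measurable_funM => //; exact: measurable_rV_coord.
Qed.

Lemma affine_fun_eq0 h (P : set 'rV[R]_n) : affine_fun h -> P° 0 ->
  (forall y, P y -> h y = 0) -> forall y, h y = 0.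
Proof.
move=> [c [u hE]] /nbhs_ballP[e /= e0 eP] h0.
have c0 : c = 0.
  have /eP/h0 : ball (0 : 'rV[R]_n) e 0 by exact: ballxx.
  by rewrite hE big1 ?addr0// => i _; rewrite mxE mulr0.
have u0 : u = 0.
  apply/rowP => i; rewrite mxE.
  have /eP/h0 : ball (0 : 'rV[R]_n) e ((e / 2) *: delta_mx ord0 i).
    rewrite ball_rVE// => j /=; rewrite !mxE /ball/= sub0r normrN.
    rewrite ?eqxx/= normrM gtr0_norm ?divr_gt0//; case: (_ == _) => /=.
      by rewrite normr1 mulr1 ltr_pdivrMr// mulr_natr mulr2n ltrDl.
    by rewrite normr0 mulr0.
  rewrite hE c0 add0r (bigD1 i)//= big1 => [|j ji]; last first.
    by rewrite !mxE (negbTE ji) andbF !mulr0.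
  rewrite !mxE !eqxx/= mulr1 addr0 => /eqP; rewrite mulf_eq0.
  by rewrite mulf_eq0 invr_eq0 pnatr_eq0 (gt_eqF e0)/= orbF => /eqP.
by move=> y; rewrite hE c0 u0 add0r big1// => i _; rewrite mxE mul0r.
Qed.

End affine_functions.

(** * Convex functions: from almost everywhere to everywhere *)

Section convex_functions.
Context (R : realType) (n : nat) (P : set 'rV[R]_n).
Hypothesis P_body : convex_body P.
Local Notation mu := (lebesgue_rV R n).
Implicit Types (f g : 'rV[R]_n -> \bar R) (h : 'rV[R]_n -> R).
Implicit Types (x y w : 'rV[R]_n).

Lemma convex_on_real f (t : R) x y (a b : R) : convex_on P f ->
  0 <= t -> t <= 1 -> P x -> P y -> (f x <= a%:E)%E -> (f y <= b%:E)%E ->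
  (f (t *: x + (1 - t) *: y)%R <= (t * a + (1 - t) * b)%R%:E)%E.
Proof.
move=> [_ cf] t0 t1 Px Py fx fy.
apply: le_trans (cf (Itv01 t0 t1) x y Px Py) _ => /=.
rewrite [leRHS]EFinD !EFinM; apply: leeD; apply: lee_wpmul2l => //.
by rewrite lee_fin subr_ge0.
Qed.

Lemma convex_onD f g : convex_on P f -> convex_on P g ->
  convex_on P (fun y => f y + g y)%E.
Proof.
move=> [f0 cf] [g0 cg]; split=> [y Py|t x y Px Py].
  by rewrite ltNye adde_eq_ninfty negb_or -!ltNye f0// g0.
apply: le_trans (leeD (cf t x y Px Py) (cg t x y Px Py)) _.
have t1 : 0 <= 1 - t%:num by rewrite subr_ge0.
rewrite !muleDr//; last 2 first.
  by apply: ltninfty_adde_def; rewrite inE; [exact: f0|exact: g0].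
  by apply: ltninfty_adde_def; rewrite inE; [exact: f0|exact: g0].
by rewrite addeACA.
Qed.

Let mule_gtNy (r : R) (z : \bar R) : 0 <= r -> (-oo < z -> -oo < r%:E * z)%E.
Proof.
case: z => [z||]//; rewrite le_eqVlt => /orP[/eqP <-|r0] _.
- by rewrite mul0e ltNyr.
- by rewrite -EFinM ltNyr.
- by rewrite mul0e ltNyr.
- by rewrite gt0_muley ?lte_fin.
Qed.

Lemma convex_onZ f (c : R) : 0 < c -> convex_on P f ->
  convex_on P (fun y => c%:E * f y)%E.
Proof.
move=> c0 [f0 cf]; split=> [y /f0|t x y Px Py].
  by apply: mule_gtNy; exact: ltW.
apply: le_trans (lee_wpmul2l _ (cf t x y Px Py)) _.
  by rewrite lee_fin ltW.
rewrite muleDr//; first by rewrite !muleA ![(c%:E * _%:E)%E]muleC.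
by apply: ltninfty_adde_def; rewrite inE; apply: mule_gtNy;
  rewrite ?subr_ge0//; exact: f0.
Qed.

Lemma convex_on_max0 f : convex_on P f -> convex_on P (fun y => maxe 0%E (f y)).
Proof.
move=> [f0 cf]; split=> [y Py|t x y Px Py].
  by rewrite lt_max f0// orbT.
have t1 : 0 <= 1 - t%:num by rewrite subr_ge0.
rewrite ge_max; apply/andP; split.
  by apply: adde_ge0; apply: mule_ge0 => //; rewrite le_max lexx.
apply: le_trans (cf t x y Px Py) _.
by apply: leeD; apply: lee_wpmul2l => //; rewrite le_max lexx orbT.
Qed.

Lemma convex_on_affine h : affine_fun h -> convex_on P (EFin \o h).
Proof.
move=> ah; split=> [y _|t x y _ _]; first by rewrite ltNyr.
by rewrite /= affine_fun_conv// [leLHS]EFinD !EFinM.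
Qed.

(** Suppose [f(y) < h(y)] and join [y] to a generic point [w] of the interior,
    where [f] is finite. By convexity [f < h] at all points of the segment
    close to [y], in particular at [(1 / k) w + (1 - 1 / k) y] for large [k];
    but [w] can be chosen so that all these points lie outside the exceptional
    null set. *)
Lemma ae_ge_affine f h : convex_on P f -> affine_fun h ->
  {ae mu, forall y, P y -> (f y < +oo)%E /\ ((h y)%:E <= f y)%E} ->
  forall y, P y -> ((h y)%:E <= f y)%E.
Proof.
move=> cf ah aef y Py; rewrite leNgt; apply/negP => fy.
(* the index [k = 0] gives the point [w] itself *)
pose s k : R := k.+1%:R^-1.
have s0 k : 0 < s k by rewrite invr_gt0.
have s1 k : s k <= 1 by rewrite invf_le1// ler1n.
have sN k : s k != 0 by rewrite gt_eqF.
have [_ _ P0] := P_body.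
have -[w Pw gen] := exists_generic_point (fun k => (1 - s k) *: y)
  (open_interior P) P0 aef sN.
have {Pw}Pw : P w by exact: interior_subset.
have {}gen k : (f (s k *: w + (1 - s k) *: y)%R < +oo)%E /\
    ((h (s k *: w + (1 - s k) *: y)%R)%:E <=
                f (s k *: w + (1 - s k) *: y)%R)%E.
  have /contrapT := gen k; case=> //.
  by apply: (convex_bodyP P_body) => //; exact/ltW.
have fwy : (f w < +oo)%E.
  have [+ _] := gen 0%N.
  by rewrite /s invr1 subrr scale1r scale0r addr0.
have [f0 _] := cf.
have [a fa] : exists a, f w = a%:E.
  exists (fine (f w)); rewrite fineK// fin_numE -ltNye -ltey f0//.
have [b fb] : exists b, f y = b%:E.
  exists (fine (f y)); rewrite fineK// fin_numE -ltNye -ltey f0//.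
  by rewrite (lt_trans fy)// ltry.
move: fy; rewrite fb lte_fin -subr_gt0 => hb.
have key k : k%:R * (h y - b) <= a - h w.
  have := le_trans (gen k).2
    (convex_on_real (a := a) (b := b) cf (ltW (s0 k)) (s1 k) Pw Py _ _).
  rewrite fa fb !lexx lee_fin => /(_ isT isT); rewrite affine_fun_conv//.
  have k1 : k.+1%:R * s k = 1 by rewrite mulfV.
  have k0 : 0 < k.+1%:R :> R by [].
  rewrite -(ler_pM2l k0) !mulrDr !mulrA k1 !mulrBr !mulr1 k1 -natr1.
  by lra.
have /archi_boundP : 0 <= `|a - h w| / (h y - b) by rewrite divr_ge0// ltW.
rewrite ltr_pdivrMr// => /(le_lt_trans (ler_norm _)).
by rewrite ltNge key.
Qed.

(** An interior point is the midpoint of arbitrarily close pairs of points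
    outside a given null set; convexity then bounds the value at the midpoint
    from above. *)
Lemma exists_reflected_pair y (N U : set 'rV[R]_n) :
  P° y -> mu.-negligible N -> nbhs (0 : 'rV[R]_n) U ->
  exists w, [/\ U w, U (- w), P (y + w) /\ P (y - w) &
    ~ N (y + w) /\ ~ N (y - w)].
Proof.
move=> /nbhs_ballP[e /= e0 eP] N0 /nbhs_ballP[d /= d0 dU].
pose r := Num.min e d.
have r0 : 0 < r by rewrite lt_min e0.
have re : r <= e by rewrite ge_min lexx.
have rd : r <= d by rewrite ge_min lexx orbT.
(* the maps [w |-> y + w] and [w |-> y - w] *)
pose s (k : nat) : R := if k == 0%N then 1 else -1.
have sN k : s k != 0 by rewrite /s; case: ifP => _; rewrite ?oppr_eq0 oner_neq0.
have B0 : ball (0 : 'rV[R]_n) r !=set0 by exists 0; exact: ballxx.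
have [w wr gen] :=
  exists_generic_point (fun=> y) (ball_open (0 : 'rV[R]_n) r) B0 N0 sN.
have {}wr : `|w| < r by move: wr; rewrite mx_norm_ball /ball_/= sub0r normrN.
exists w; split.
- by apply: dU; rewrite mx_norm_ball /ball_/= sub0r normrN (lt_le_trans wr).
- by apply: dU; rewrite mx_norm_ball /ball_/= sub0r opprK (lt_le_trans wr).
- split; apply: eP; rewrite mx_norm_ball /ball_/=.
    by rewrite opprD addrA subrr sub0r normrN (lt_le_trans wr).
  by rewrite opprB addrCA subrr addr0 (lt_le_trans wr).
- have := gen 0%N; have := gen 1%N; rewrite /s/= scale1r scaleN1r.
  by rewrite addrC [w + y]addrC.
Qed.

Lemma half_midpoint y w : y = (1 / 2) *: (y + w) + (1 - 1 / 2) *: (y - w).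
Proof.
by apply/rowP => i; rewrite !mxE; field.
Qed.

Lemma convex_on_interior_lty f y : convex_on P f ->
  {ae mu, forall x, P x -> (f x < +oo)%E} -> P° y -> (f y < +oo)%E.
Proof.
move=> cf aef yP.
have [w [_ _ [P1 P2] [N1 N2]]] := exists_reflected_pair yP aef filterT.
have {}N1 : (f (y + w)%R < +oo)%E by move/contrapT : N1; exact.
have {}N2 : (f (y - w)%R < +oo)%E by move/contrapT : N2; exact.
rewrite (half_midpoint y w).
have h0 : 0 <= 1 / 2 :> R by lra.
have h1 : 1 / 2 <= 1 :> R by lra.
apply: le_lt_trans (convex_on_real (a := fine (f (y + w)))
  (b := fine (f (y - w))) cf h0 h1 P1 P2 _ _) (ltry _).
  by rewrite fineK// fin_numE -ltNye -ltey N1; case: cf => ->.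
by rewrite fineK// fin_numE -ltNye -ltey N2; case: cf => ->.
Qed.

Lemma ae_le_continuous f (g : 'rV[R]_n -> R) y : convex_on P f ->
  {for y, continuous g} ->
  {ae mu, forall x, P x -> (f x <= (g x)%:E)%E} -> P° y -> (f y <= (g y)%:E)%E.
Proof.
move=> cf cg aef yP; apply/lee_addgt0Pr => e e0.
have U0 : nbhs (0 : 'rV[R]_n) [set w | g (y + w) <= g y + e].
  have : nbhs y [set x | g x <= g y + e].
    have /cvgrPdist_le /(_ e e0) := cg; apply: filterS => x.
    by rewrite ler_distl => /andP[]; rewrite lerBlDr.
  move=> /nbhs_ballP[d /= d0 dU]; apply/nbhs_ballP; exists d => // w.
  rewrite mx_norm_ball /ball_/= sub0r normrN => wd; apply: dU.
  by rewrite mx_norm_ball /ball_/= opprD addrA subrr sub0r normrN.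
have [w [U1 U2 [P1 P2] [N1 N2]]] := exists_reflected_pair yP aef U0.
have {}N1 : (f (y + w)%R <= (g (y + w)%R)%:E)%E by move/contrapT : N1; exact.
have {}N2 : (f (y - w)%R <= (g (y - w)%R)%:E)%E by move/contrapT : N2; exact.
rewrite [in leLHS](half_midpoint y w).
have h0 : 0 <= 1 / 2 :> R by lra.
have h1 : 1 / 2 <= 1 :> R by lra.
apply: le_trans (convex_on_real cf h0 h1 P1 P2 N1 N2) _.
by rewrite lee_fin; move: U1 U2 => /=; lra.
Qed.

End convex_functions.

(** * Subgradients *)

Section subgradient.
Context (R : realType) (n : nat) (Q : set 'rV[R]_n) (F : 'rV[R]_n -> R).
Implicit Types (x y v : 'rV[R]_n) (i : 'I_n).

Let L (u x : 'rV[R]_n) : R := \sum_(i < n) u ord0 i * x ord0 i.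

Let LD u (a b : R) x y : L u (a *: x + b *: y) = a * L u x + b * L u y.
Proof.
rewrite /L !mulr_sumr -big_split; apply: eq_bigr => i _ /=.
by rewrite !mxE; ring.
Qed.

(* [Q] stands for the set where an extended-valued convex function is finite. *)
Hypothesis F_convex : forall (s t : R) x y, 0 < s -> 0 < t -> s + t = 1 ->
  Q x -> Q y ->
  Q (s *: x + t *: y) /\ F (s *: x + t *: y) <= s * F x + t * F y.
Hypothesis Q_absorbing : forall v, exists2 s : R, 0 < s & Q (s *: v).

(* [F 0 + L u] is below [F] on the span of the first [k] basis vectors. *)
Let supports k u := forall x, Q x ->
  (forall i, (k <= i)%N -> x ord0 i = 0) -> F 0 + L u x <= F x.

(* The slope [c] along the basis vector [e] has to lie above all difference
   quotients taken in the direction [- e] and below all those taken in the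
   direction [e]. Convexity on the segment from [x - s e] to [x' + s' e], which
   crosses the span already treated, puts the former below the latter. *)
Let extend (k : 'I_n) u : supports k u -> exists u', supports k.+1 u'.
Proof.
move=> Hu; pose e : 'rV[R]_n := delta_mx ord0 k.
pose V x := forall i, (k <= i)%N -> x ord0 i = 0.
pose S := [set r | exists s x, [/\ 0 < s, V x, Q (x - s *: e) &
  r = (F 0 + L u x - F (x - s *: e)) / s]].
have S_ub s' x' : 0 < s' -> V x' -> Q (x' + s' *: e) ->
    ubound S ((F (x' + s' *: e) - F 0 - L u x') / s').
  move=> s'0 Vx' Qx' _ [s [x [s0 Vx Qx ->]]].
  have ss0 : 0 < s + s' by exact: addr_gt0.
  pose a := s' / (s + s'); pose b := s / (s + s').
  have a0 : 0 < a by exact: divr_gt0.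
  have b0 : 0 < b by exact: divr_gt0.
  have ab : a + b = 1 by rewrite /a /b; field; rewrite gt_eqF.
  have mE : a *: (x - s *: e) + b *: (x' + s' *: e) = a *: x + b *: x'.
    apply/rowP => i; rewrite !mxE /a /b; field; by rewrite gt_eqF.
  have aE : (s + s') * a = s' by rewrite /a; field; rewrite gt_eqF.
  have bE : (s + s') * b = s by rewrite /b; field; rewrite gt_eqF.
  clearbody a b.
  have [Qm] := F_convex a0 b0 ab Qx Qx'.
  rewrite {}mE in Qm * => Fm.
  have : F 0 + L u (a *: x + b *: x') <= F (a *: x + b *: x').
    by apply: Hu => // i ki; rewrite !mxE Vx// Vx'// !mulr0 addr0.
  rewrite LD => /le_trans /(_ Fm).
  rewrite -(ler_pM2l ss0) => h.
  rewrite ler_pdivrMr// mulrAC ler_pdivlMr//.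
  move: h; rewrite !mulrDr !mulrA aE bE; lra.
have V0 : V 0 by move=> i _; rewrite mxE.
have S_sup : has_sup S.
  split.
    have [s s0 Qs] := Q_absorbing (- e).
    exists ((F 0 + L u 0 - F (0 - s *: e)) / s), s, 0; split=> //.
    by rewrite sub0r -scalerN.
  have [s s0 Qs] := Q_absorbing e.
  exists ((F (0 + s *: e) - F 0 - L u 0) / s).
  by apply: S_ub => //; rewrite add0r.
pose c := sup S.
pose u' := \row_i (if i == k then c else u ord0 i).
exists u' => x Qx Vx.
pose t := x ord0 k.
pose x0 := x - t *: e.
have Vx0 : V x0.
  move=> i ki; rewrite !mxE eqxx/=; have [->|ik] := eqVneq i k.
    by rewrite mulr1 subrr.
  rewrite Vx ?mulr0 ?subr0// ltn_neqAle ki andbT.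
  by apply: contra ik => /eqP ki'; apply/eqP/val_inj.
have Lx : L u' x = L u x0 + c * t.
  rewrite /L (bigD1 k)//= [in RHS](bigD1 k)//= mxE eqxx (Vx0 k)//.
  rewrite mulr0 add0r addrC; congr (_ + _); apply: eq_bigr => i ik.
  by rewrite !mxE (negbTE ik) andbF mulr0 subr0.
have xE : x = x0 + t *: e by rewrite subrK.
rewrite Lx; have [t0|t0|t0] := ltrgt0P t.
- have : c <= (F (x0 + t *: e) - F 0 - L u x0) / t.
    by apply: ge_sup; [case: S_sup|apply: S_ub => //; rewrite -xE].
  by rewrite -xE ler_pdivlMr//; lra.
- have : (F 0 + L u x0 - F (x0 - (- t) *: e)) / (- t) <= c.
    apply: sup_upper_bound => //; exists (- t), x0; split=> //.
      by rewrite oppr_gt0.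
    by rewrite scaleNr opprK -xE.
  by rewrite scaleNr opprK -xE ler_pdivrMr ?oppr_gt0//; lra.
- have x0E : x0 = x by rewrite [RHS]xE t0 scale0r addr0.
  rewrite t0 mulr0 addr0 x0E; apply: Hu => // i ki.
  by rewrite -x0E; exact: Vx0.
Qed.

(** The Hahn-Banach extension argument, one coordinate at a time. *)
Lemma exists_subgradient :
  exists u, forall x, Q x -> F 0 + L u x <= F x.
Proof.
suff [u Hu] : exists u, supports n u.
  by exists u => x Qx; apply: Hu => // i; rewrite leqNgt ltn_ord.
have : forall k, (k <= n)%N -> exists u, supports k u.
  elim=> [_|k IH kn].
    exists 0 => x _ x0; have -> : x = 0 by apply/rowP => i; rewrite x0// mxE.
    by rewrite /L big1 ?addr0// => i _; rewrite mxE mul0r.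
  have [u] := IH (ltnW kn); exact: (extend (k := Ordinal kn)).
by apply.
Qed.

End subgradient.

Section convex_support.
Context (R : realType) (n : nat) (P : set 'rV[R]_n).
Hypothesis P_body : convex_body P.
Hypothesis P0 : P° 0.

Lemma exists_affine_support (f : 'rV[R]_n -> \bar R) : convex_on P f ->
  (forall y, P° y -> (f y < +oo)%E) ->
  exists2 a, affine_fun a & f 0 = (a 0)%:E /\
    forall y, P y -> ((a y)%:E <= f y)%E.
Proof.
move=> cf foo; have [fNy _] := cf.
have P_0 : P 0 by exact: interior_subset.
pose Q := [set y | P y /\ (f y < +oo)%E].
have fE y : Q y -> f y = (fine (f y))%:E.
  by move=> [Py fy]; rewrite fineK// fin_numE -ltNye -ltey fNy.
have Q0 : Q 0 by split=> //; exact: foo.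
have [||u Hu] := @exists_subgradient R n Q (fine \o f).
- move=> s t x y s0 t0 st Qx Qy; have [Px _] := Qx; have [Py _] := Qy.
  have tE : t = 1 - s by rewrite -st addrAC subrr add0r.
  have s1 : s <= 1 by rewrite -st lerDl ltW.
  have Pm : P (s *: x + t *: y).
    by rewrite tE; apply: (convex_bodyP P_body) => //; exact: ltW.
  have fm : (f (s *: x + t *: y)%R <=
      (s * fine (f x) + t * fine (f y))%R%:E)%E.
    by rewrite tE; apply: (convex_on_real cf (ltW s0)) => //; rewrite -fE.
  have Qm : Q (s *: x + t *: y) by split=> //; rewrite (le_lt_trans fm)// ltry.
  by split=> //; rewrite -lee_fin -fE.
- move=> v; have /nbhs_ballP[e /= e0 eP] :=
    open_nbhs_nbhs (conj (open_interior P) P0).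
  have v0 : 0 < `|v| + 1 by rewrite ltr_wpDl.
  exists (e / (`|v| + 1)); first by rewrite divr_gt0.
  have Pv : P° (e / (`|v| + 1) *: v).
    apply: eP; rewrite mx_norm_ball /ball_/= sub0r normrN normrZ.
    rewrite gtr0_norm ?divr_gt0// mulrAC ltr_pdivrMr// mulrDr mulr1 ltrDl.
    exact: e0.
  by split; [exact: interior_subset|exact: foo].
pose a (y : 'rV[R]_n) := fine (f 0) + \sum_(i < n) u ord0 i * y ord0 i.
have aa : affine_fun a by exists (fine (f 0)), u.
exists a => //; split.
  by rewrite fE// /a big1 ?addr0// => i _; rewrite mxE mulr0.
move=> y Py; have [fy|] := boolP (f y < +oo)%E.
  by rewrite fE// lee_fin; exact: Hu.
by rewrite -leNgt leye_eq => /eqP ->; rewrite leey.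
Qed.

End convex_support.

(** * Representing linear forms on affine functions *)

Section affine_projection.
Context (R : realType) (n : nat) (P : set 'rV[R]_n).
Hypothesis P_body : convex_body P.
Hypothesis P0 : P° 0.
Local Notation mu := (lebesgue_rV R n).
Local Notation sqint := (sq_integrable mu P).
Local Notation dot := (L2dot mu P).
Implicit Types (h F : 'rV[R]_n -> R) (f : 'rV[R]_n -> \bar R).

Let mP : measurable P := convex_body_measurable P_body.

Lemma sq_integrable_cst (c : R) : sqint (fun=> c).
Proof.
split=> //; apply/integrableP; split=> //.
rewrite integral_cst//; apply: lte_mul_pinfty => //.
exact: convex_body_lty P_body.
Qed.

Lemma affine_fun_bounded h : affine_fun h ->
  exists M, forall y, P y -> `|h y| <= M.
Proof.
move=> ah; have [cP _ _] := P_body.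
have ch : {within P, continuous h}.
  by apply: continuous_subspaceT; exact: continuous_affine_fun.
have [M [_ MP]] := compact_bounded (continuous_compact ch cP).
have M1 : M < `|M| + 1 by rewrite (le_lt_trans (ler_norm _))// ltrDl.
by exists (`|M| + 1) => y Py; apply: (MP _ M1); exists y.
Qed.

Lemma sq_integrable_affine h : affine_fun h -> sqint h.
Proof.
move=> ah; have [M hM] := affine_fun_bounded ah.
apply: (le_sq_integrable mP _ _ (sq_integrable_cst M)).
  exact: measurable_affine_fun.
by move=> x Px; rewrite (le_trans (hM x Px))// ler_norm.
Qed.

Lemma affine_ae_ge0 h : affine_fun h ->
  {ae mu, forall y, P y -> 0 <= h y} -> forall y, P y -> 0 <= h y.
Proof.
move=> ah h0 y Py; rewrite -lee_fin.
apply: (ae_ge_affine P_body (f := EFin \o h) (h := fun=> 0)) Py.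
- exact: convex_on_affine.
- exact: affine_fun_cst.
- by apply: filterS h0 => x h0 /h0 hx; rewrite ltry lee_fin.
Qed.

Lemma affine_ae_eq0 h : affine_fun h ->
  {ae mu, forall y, P y -> h y = 0} -> forall y, h y = 0.
Proof.
move=> ah h0; apply: (affine_fun_eq0 ah P0) => y Py.
apply/eqP; rewrite eq_le; apply/andP; split; last first.
  by apply: (affine_ae_ge0 ah) Py; apply: filterS h0 => x h0 /h0 ->.
rewrite -oppr_ge0 -mulN1r.
apply: (affine_ae_ge0 (affine_funZ _ ah)) Py.
by apply: filterS h0 => x h0 /h0 ->; rewrite mulr0.
Qed.

(* The basis of affine functions: the constant [1] and the coordinates. *)
Let e (k : 'I_n.+1) (y : 'rV[R]_n) : R :=
  if unlift ord0 k is Some j then y ord0 j else 1.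

Let e_affine k : affine_fun (e k).
Proof.
rewrite /e; case: (unlift ord0 k) => [j|]; first exact: affine_fun_coord.
exact: affine_fun_cst.
Qed.

Let aff (v : 'rV[R]_n.+1) (y : 'rV[R]_n) := \sum_k v ord0 k * e k y.

Let affE v y : aff v y =
  v ord0 ord0 + \sum_(i < n) v ord0 (lift ord0 i) * y ord0 i.
Proof.
rewrite /aff big_ord_recl /e unlift_none mulr1; congr (_ + _).
by apply: eq_bigr => i _; rewrite liftK.
Qed.

Let aff_affine v : affine_fun (aff v).
Proof.
exists (v ord0 ord0), (\row_i v ord0 (lift ord0 i)) => y; rewrite affE.
by congr (_ + _); apply: eq_bigr => i _; rewrite mxE.
Qed.

Let affine_aff h : affine_fun h -> exists v, h = aff v.
Proof.
move=> [c [u hE]].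
exists (\row_k if unlift ord0 k is Some j then u ord0 j else c).
apply/funext => y; rewrite hE affE mxE unlift_none; congr (_ + _).
by apply: eq_bigr => i _; rewrite mxE liftK.
Qed.

Let aff_eq0 v : (forall y, aff v y = 0) -> v = 0.
Proof.
move=> v0; have v00 : v ord0 ord0 = 0.
  by rewrite -[RHS](v0 0) affE big1 ?addr0// => i _; rewrite mxE mulr0.
apply/rowP => k; rewrite mxE; case: (unliftP ord0 k) => [j ->|->//].
rewrite -[RHS](v0 (delta_mx ord0 j)) affE v00 add0r (bigD1 j)//=.
rewrite big1 => [|i ij].
  by rewrite mxE !eqxx mulr1 addr0.
by rewrite mxE (negbTE ij) andbF mulr0.
Qed.

Let dot_affl v F : sqint F -> dot (aff v) F = \sum_k v ord0 k * dot (e k) F.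
Proof.
have ie k : sqint (e k) by exact: sq_integrable_affine.
move=> iF; have ive k : sqint (fun y => v ord0 k * e k y).
  exact: sq_integrableZ.
rewrite /aff (dot_suml mP _ ive iF).2.
by apply: eq_bigr => k _; rewrite dotZl.
Qed.

Let gram : 'M[R]_n.+1 := \matrix_(k, l) dot (e k) (e l).

(* A vector [v] in the kernel satisfies [dot (aff v) (aff v) = 0], and an affine
   function vanishing almost everywhere on a body is zero. *)
Let gram_unit : gram \in unitmx.
Proof.
rewrite -row_free_unit -kermx_eq0; apply/rowV0P => v /sub_kermxP vG.
apply/aff_eq0/affine_ae_eq0; first exact: aff_affine.
have iv := sq_integrable_affine (aff_affine v).
apply: (dot_eq0 mP iv); rewrite dot_affl// big1// => k _.
rewrite dotC dot_affl; last exact: sq_integrable_affine.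
have := congr1 (fun A : 'rV_n.+1 => A ord0 k) vG; rewrite !mxE => h.
rewrite (_ : \sum_l _ = 0) ?mulr0// -[RHS]h.
by apply: eq_bigr => l _; rewrite mxE.
Qed.

(* [c k] is the value of the linear form at [e k]. *)
Let affine_riesz (c : 'I_n.+1 -> R) :
  exists2 p, affine_fun p & forall v, dot p (aff v) = \sum_k v ord0 k * c k.
Proof.
pose w := (\row_k c k) *m invmx gram.
exists (aff w); first exact: aff_affine.
move=> v; rewrite dotC dot_affl; last exact/sq_integrable_affine/aff_affine.
apply: eq_bigr => k _; congr (_ * _).
rewrite dotC dot_affl; last exact: sq_integrable_affine.
have <- : (w *m gram) ord0 k = c k by rewrite /w mulmxKV// mxE.
by rewrite mxE; apply: eq_bigr => l _; congr (_ * _); rewrite mxE.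
Qed.

(** A Ricci affine function exists because evaluation at [0] is a linear form on
    affine functions. *)
Lemma ricci_affineP : is_ricci_affine P (ricci_affine P).
Proof.
apply: (@getPex _ (is_ricci_affine P)).
have [p ap pE] := affine_riesz (fun k => e k 0).
exists p; split=> // h /affine_aff[v ->].
have -> : \int[mu]_(y in P) (aff v y * p y) = dot p (aff v) by rewrite dotC.
by rewrite pE addNr.
Qed.

(** Likewise for the linear form [h |-> dot F h]. *)
Lemma affine_projP f F : represents P f F ->
  is_affine_proj P f (affine_proj P f).
Proof.
move=> rF; apply: (@getPex _ (is_affine_proj P f)).
have [p ap pE] := affine_riesz (fun k => dot (e k) F).
have [iF fF] := rF.
have ip := sq_integrable_affine ap.
exists p; split=> // h /[dup] ah /affine_aff[v hE].
have ih := sq_integrable_affine ah.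
have rFp : represents P (fun y => f y - (p y)%:E)%E (fun y => F y - p y).
  split; first exact: sq_integrableB.
  by apply: filterS fF => y fF /fF ->.
rewrite (represents_integral_mul mP rFp ih) dotBl//; congr EFin.
by rewrite hE pE dotC dot_affl// subrr.
Qed.

End affine_projection.

(** * Densities of minimal norm *)

Section minimal_norm.
Context (R : realType) (n : nat) (P : set 'rV[R]_n).
Hypothesis P_body : convex_body P.
Hypothesis P0 : P° 0.
Local Notation mu := (lebesgue_rV R n).
Local Notation sqint := (sq_integrable mu P).
Local Notation dot := (L2dot mu P).
Local Notation ell := (ricci_affine P).
Implicit Types (h a F G B C : 'rV[R]_n -> R) (f g b c : 'rV[R]_n -> \bar R).

Let mP : measurable P := convex_body_measurable P_body.
Let i_aff h : affine_fun h -> sqint h := @sq_integrable_affine R n P P_body h.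
Let cst_aff (r : R) : affine_fun (fun _ : 'rV[R]_n => r) := affine_fun_cst n r.

Let ell_affine : affine_fun ell.
Proof. by have [] := ricci_affineP P_body P0. Qed.

Lemma dot_ricci h : affine_fun h -> dot h ell = h 0.
Proof.
have [_ hE] := ricci_affineP P_body P0.
by move=> /hE /eqP; rewrite addrC subr_eq0 => /eqP.
Qed.

(** Total mass [1] and barycentre [0], in a form without coordinates. *)
Definition centered F := forall h, affine_fun h -> dot F h = h 0.

Lemma centeredP F : sqint F -> dot F (fun=> 1) = 1 ->
  (forall i, dot F (fun y => y ord0 i) = 0) -> centered F.
Proof.
move=> iF F1 Fi h [c [u hE]].
have ih i : sqint (fun y => u ord0 i * y ord0 i).
  exact/i_aff/affine_funZ/affine_fun_coord.
have [is0 sE] := dot_suml mP (index_enum 'I_n) ih iF.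
have -> : h = (fun y => c * 1 + \sum_(i < n) u ord0 i * y ord0 i).
  by apply/funext => y; rewrite mulr1.
rewrite dotC dotDl//; last exact: i_aff.
rewrite sE dotZl// ; last exact: i_aff.
rewrite [dot (fun=> 1) F]dotC F1 !big1// => i _; first by rewrite mxE mulr0.
by rewrite dotZl//; [rewrite dotC Fi mulr0|exact/i_aff/affine_fun_coord].
Qed.

Lemma frakB_represents c : frakB P c -> exists C, represents P c C.
Proof. by move=> [_ cL2 _ _]; exact: L2_represents. Qed.

Lemma frakB_centered c C : frakB P c -> represents P c C ->
  {ae mu, forall y, P y -> 0 <= C y} /\ centered C.
Proof.
move=> [c0 _ c1 ci] rC; have [iC cC] := rC; split.
  by apply: filterS2 c0 cC => y c0 cC Py; rewrite -lee_fin -cC// c0.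
apply: centeredP => // [|i].
  apply: EFin_inj; rewrite -(represents_integral_mul mP rC (i_aff (cst_aff 1))).
  by under eq_integral do rewrite mule1.
have ii := i_aff (affine_fun_coord R i).
apply: EFin_inj; rewrite -(represents_integral_mul mP rC ii).
by under eq_integral do rewrite muleC.
Qed.

Lemma centered_frakB c C : represents P c C ->
  {ae mu, forall y, P y -> 0 <= C y} -> centered C -> frakB P c.
Proof.
move=> rC C0 Ch; have [iC cC] := rC; split.
- by apply: filterS2 C0 cC => y C0 cC Py; rewrite cC// lee_fin C0.
- exact: represents_L2 rC.
- have := represents_integral_mul mP rC (i_aff (cst_aff 1)).
  rewrite Ch//; under eq_integral do rewrite mule1.
  by [].
- move=> i; have ii := i_aff (affine_fun_coord R i).
  have := represents_integral_mul mP rC ii.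
  rewrite Ch; last exact: affine_fun_coord.
  rewrite mxE; under eq_integral do rewrite muleC.
  by [].
Qed.

(** The first-order condition for [B] to be the projection of [0] onto the
    convex set of densities: expand the square of the norm of [C - B]. *)
Lemma min_norm_criterion b B : represents P b B -> frakB P b ->
  (forall c C, frakB P c -> represents P c C -> dot B B <= dot C B) ->
  is_unique_min_norm P b.
Proof.
move=> rB bB Bmin; have [iB bBE] := rB; split=> // c cB.
  have [C rC] := frakB_represents cB.
  have [iC _] := rC; have := dot_ge0 mu P (fun y => C y - B y).
  rewrite dot_sqrB//.
  rewrite (represents_L2norm mP rB) (represents_L2norm mP rC) lee_fin.
  by move=> CB; apply: ler_wsqrtr; have := Bmin _ _ cB rC; lra.
move=> /(_ b bB).
have [C rC] := frakB_represents cB.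
rewrite (represents_L2norm mP rB) (represents_L2norm mP rC) lee_fin.
rewrite ler_sqrt ?dot_ge0// => CB.
have [iC cC] := rC.
have : {ae mu, forall y, P y -> C y - B y = 0}.
  apply: (dot_eq0 mP (sq_integrableB mP iC iB)).
  by rewrite dot_sqrB//; have := Bmin _ _ cB rC; lra.
move=> CB0; apply: filterS3 cC bBE CB0 => y cCy bBy CB0 Py.
by rewrite cCy// bBy// -[C y](subrK (B y)) CB0// add0r.
Qed.

Lemma ricci_min_norm : 0 <= inf [set ell y | y in P] ->
  is_unique_min_norm P (EFin \o ell).
Proof.
move=> inf0; have il := i_aff ell_affine.
have ell0 y : P y -> 0 <= ell y.
  move=> Py; apply: le_trans inf0 _; apply: ge_inf; last by exists y.
  have [M ellM] := affine_fun_bounded P_body ell_affine.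
  by exists (- M) => _ [z /ellM + <-]; rewrite ler_norml => /andP[].
have rl := represents_EFin il.
apply: (min_norm_criterion rl).
  apply: (centered_frakB rl); first by apply: aeW.
  by move=> h ah; rewrite dotC dot_ricci.
move=> c C cB rC; have [_ Ch] := frakB_centered cB rC.
by rewrite dot_ricci// Ch.
Qed.

Section positive_part.
Variable a : 'rV[R]_n -> R.
Hypothesis a_affine : affine_fun a.
Let m y := Num.max 0 (a y).

Lemma pospart_sq_integrable : sqint m.
Proof. exact: (sq_integrable_max mP (i_aff (cst_aff 0)) (i_aff a_affine)). Qed.

Lemma pospart_continuous : continuous m.
Proof.
move=> y; apply: (@continuous_max _ _ (fun=> 0) a y);
exact: continuous_affine_fun.
Qed.

Lemma pospart_convex : convex_on P (EFin \o m).
Proof.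
have := convex_on_max0 (convex_on_affine P a_affine).
by under [X in convex_on _ X -> _]eq_fun do rewrite /= -EFin_max.
Qed.

Lemma pospart_integral h : affine_fun h ->
  \int[mu]_(y in P `&` [set y | 0 < a y]) (h y * a y) = dot m h.
Proof.
move=> ah; rewrite Rintegral_mkcondr; apply: eq_Rintegral => y _.
rewrite /patch /m; case: ifPn => [|].
  by rewrite inE /= => /ltW a0; rewrite max_r// mulrC.
by rewrite notin_setE /= => /negP; rewrite -leNgt => a0; rewrite max_l// mul0r.
Qed.

Lemma normalized_pospartP : is_normalized_positive_part P a <-> centered m.
Proof.
have E1 : \int[mu]_(y in P `&` [set y | 0 < a y]) a y = dot m (fun=> 1).
  rewrite -pospart_integral; last exact: cst_aff.
  by apply: eq_Rintegral => y _; rewrite mul1r.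
split=> [[_ a1 ai]|mh].
  apply: centeredP; first exact: pospart_sq_integrable.
    by rewrite -E1.
  by move=> i; rewrite -pospart_integral ?ai//; exact: affine_fun_coord.
split=> //; first by rewrite E1 mh.
move=> i; rewrite pospart_integral; last exact: affine_fun_coord.
by rewrite mh ?mxE//; exact: affine_fun_coord.
Qed.

Hypothesis m_centered : centered m.

Let dot_mm : dot m m = a 0.
Proof.
(* [m * m = m * a] pointwise *)
rewrite -m_centered//; apply: eq_Rintegral => y _; rewrite /m.
by case: (leP 0 (a y)) => // _; rewrite !mul0r.
Qed.

(** [a 0] is the squared norm of [m], which has mass [1]. *)
Lemma pospart_gt0 : 0 < a 0.
Proof.
rewrite -dot_mm lt_neqAle eq_sym dot_ge0 andbT; apply/eqP => m0.
have mm0 : dot m m <= 0 by rewrite m0.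
have := dot_eq0 mP pospart_sq_integrable mm0.
move=> /(@eq_dot_ae _ _ _ mu P m (fun=> 0) (fun=> 1)).
rewrite m_centered// [RHS](_ : _ = 0) => [/eqP|]; first by rewrite oner_eq0.
rewrite /L2dot; under eq_Rintegral do rewrite mul0r.
by rewrite Rintegral_cst// mul0r.
Qed.

(** Jensen's inequality for [m], obtained from [m >= a]. *)
Lemma pospart_dot_min C : sqint C -> {ae mu, forall y, P y -> 0 <= C y} ->
  centered C -> dot m m <= dot C m.
Proof.
move=> iC C0 Ch; have im := pospart_sq_integrable.
rewrite dot_mm -Ch// dotC [leRHS]dotC.
apply: le_dot => //; first exact: i_aff.
apply: filterS C0 => y C0 /C0 Cy.
by apply: mulr_ge0 => //; rewrite subr_ge0 le_max lexx orbT.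
Qed.

Lemma pospart_min_norm b : represents P b m -> is_unique_min_norm P b.
Proof.
move=> rb; apply: (min_norm_criterion rb).
  by apply: (centered_frakB rb) => //; apply: aeW => y _; rewrite le_max lexx.
move=> c C cB rC; have [C0 Ch] := frakB_centered cB rC.
by apply: pospart_dot_min => //; case: rC.
Qed.

(** [m] is continuous and is a maximum of two affine functions, so both
    principles from almost everywhere to everywhere apply. *)
Lemma ae_eq_pospart c : convex_on P c ->
  {ae mu, forall y, P y -> c y = (m y)%:E} ->
  forall y, P° y -> c y = (m y)%:E.
Proof.
move=> cc cm y yP; have Py : P y by exact: interior_subset.
apply/eqP; rewrite eq_le; apply/andP; split.
  apply: (ae_le_continuous cc (@pospart_continuous y)) yP.
  by apply: filterS cm => x cm /cm ->.
rewrite EFin_max ge_max; apply/andP; split.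
  apply: (ae_ge_affine P_body (h := fun=> 0) cc (cst_aff 0)) Py.
  apply: filterS cm => x cm /cm ->; rewrite ltry; split=> //.
  by rewrite lee_fin le_max lexx.
apply: (ae_ge_affine P_body cc a_affine) Py.
apply: filterS cm => x cm /cm ->; rewrite ltry; split=> //.
by rewrite lee_fin le_max lexx orbT.
Qed.

End positive_part.

(** Both positive parts are densities of minimal norm, hence they coincide, and
    both are positive at [0]; so [a1 = a2] near [0]. *)
Lemma pospart_unique a1 a2 : is_normalized_positive_part P a1 ->
  is_normalized_positive_part P a2 -> a1 = a2.
Proof.
move=> n1 n2; have [aa1 _ _] := n1; have [aa2 _ _] := n2.
have m1 := (normalized_pospartP aa1).1 n1.
have m2 := (normalized_pospartP aa2).1 n2.
pose b i : 'rV[R]_n -> \bar R := EFin \o (fun y => Num.max 0 (i y)).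
have r1 : represents P (b a1) _ := represents_EFin (pospart_sq_integrable aa1).
have r2 : represents P (b a2) _ := represents_EFin (pospart_sq_integrable aa2).
have [_ _ u1] := pospart_min_norm aa1 m1 r1.
have [b2 min2 _] := pospart_min_norm aa2 m2 r2.
have /(ae_eq_pospart aa1 (pospart_convex aa2)) mE := u1 _ b2 min2.
have a10 := pospart_gt0 aa1 m1; have a20 := pospart_gt0 aa2 m2.
have c1 : nbhs (0 : 'rV[R]_n) [set y | 0 < a1 y].
  exact: (continuous_affine_fun aa1 (open_nbhs_nbhs (conj (@open_gt R 0) a10))).
have c2 : nbhs (0 : 'rV[R]_n) [set y | 0 < a2 y].
  exact: (continuous_affine_fun aa2 (open_nbhs_nbhs (conj (@open_gt R 0) a20))).
have N0 : ([set y | 0 < a1 y] `&` [set y | 0 < a2 y] `&` P°)° 0.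
  apply: filterI; first exact: filterI.
  exact: (open_nbhs_nbhs (conj (open_interior P) P0)).
apply/funext => y; apply/eqP; rewrite -subr_eq0; apply/eqP.
apply: (affine_fun_eq0 (affine_funB aa1 aa2) N0) => z [[z1 z2] zP].
have [] := mE z zP; rewrite !max_r ?ltW// => ->.
by rewrite subrr.
Qed.

End minimal_norm.

(** * First variation of the minimization problem *)

Section minimizer.
Context (R : realType) (n : nat) (P : set 'rV[R]_n).
Hypothesis P_body : convex_body P.
Hypothesis P0 : P° 0.
Local Notation mu := (lebesgue_rV R n).
Local Notation sqint := (sq_integrable mu P).
Local Notation dot := (L2dot mu P).
Local Notation ell := (ricci_affine P).
Implicit Types (h a F G B C : 'rV[R]_n -> R) (f g b c : 'rV[R]_n -> \bar R).

Let mP : measurable P := convex_body_measurable P_body.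
Let i_aff h : affine_fun h -> sqint h := @sq_integrable_affine R n P P_body h.

Let ell_affine : affine_fun ell.
Proof. by have [] := ricci_affineP P_body P0. Qed.

Lemma represents_interior_fin g G y : convex_on P g -> represents P g G ->
  P° y -> g y = (fine (g y))%:E.
Proof.
move=> cg [_ gG] yP; rewrite fineK// fin_numE -ltNye -ltey.
rewrite (proj1 cg y (interior_subset yP)).
apply: (convex_on_interior_lty cg _ yP).
by apply: filterS gG => x gG /gG ->; rewrite ltry.
Qed.

Lemma D_NA_represents g G : convex_on P g -> represents P g G ->
  D_NA P g = (- fine (g 0) + dot G ell)%:E.
Proof.
move=> cg rG; rewrite /D_NA (represents_integral_mul mP rG (i_aff ell_affine)).
by rewrite [in LHS](represents_interior_fin cg rG P0).
Qed.

Lemma affine_proj_residual g G (p := affine_proj P g) : represents P g G ->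
  [/\ affine_fun p,
    L2norm P (fun y => g y - (p y)%:E)%E =
      (Num.sqrt (dot (fun y => G y - p y) (fun y => G y - p y)))%:E &
    forall h, affine_fun h -> dot (fun y => G y - p y) h = 0].
Proof.
move=> rG; have [ap pE] := affine_projP P_body P0 rG.
have [iG gG] := rG.
have rGp : represents P (fun y => g y - (p y)%:E)%E (fun y => G y - p y).
  split; first by apply: sq_integrableB => //; exact: i_aff.
  by apply: filterS gG => y gG /gG ->.
split=> //; first exact: represents_L2norm rGp.
move=> h ah; apply: EFin_inj.
by rewrite -(represents_integral_mul mP rGp (i_aff ah)) pE.
Qed.

Section fixed_minimizer.
Variables (f : 'rV[R]_n -> \bar R) (F : 'rV[R]_n -> R).
Hypothesis f_min : is_normalized_minimizer P f.
Hypothesis f_F : represents P f F.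

Let f_convex : convex_on P f.
Proof. by have [[]] := f_min. Qed.

Let iF : sqint F := f_F.1.

Lemma minimizer_value0 : fine (f 0) = dot F F.
Proof.
by have [_ _ _ <-] := f_min; rewrite (represents_integral_sq mP f_F).
Qed.

Lemma minimizer_orthogonal h : affine_fun h -> dot F h = 0.
Proof.
move=> ah; have [_ _ p0 _] := f_min.
have [_ _ pF] := affine_proj_residual f_F.
by rewrite -(pF h ah) p0; apply: eq_Rintegral => y _; rewrite subr0.
Qed.

Lemma W_ell_minimizer : W_ell P f = - Num.sqrt (dot F F).
Proof.
have [_ _ p0 _] := f_min.
have [_ NE _] := affine_proj_residual f_F.
rewrite /W_ell NE p0 (_ : dot _ _ = dot F F); last first.
  by apply: eq_Rintegral => y _; rewrite subr0.
rewrite (D_NA_represents f_convex f_F) minimizer_value0.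
rewrite (minimizer_orthogonal ell_affine) addr0 /= eqe.
case: ifPn => [/eqP ->|r0]; first by rewrite oppr0.
rewrite mulNr; congr (- _); apply: (mulIf r0).
by rewrite divfK// -expr2 sqr_sqrtr// dot_ge0.
Qed.

(** Minimality says that [D(g) >= - |f| |g - p|], with [p] the projection of
    [g], when [g] is not affine, and the projection shortens the norm. If [g] is
    almost everywhere equal to [p], then [D(g) = p(0) - g(0)] is nonnegative by
    convexity. *)
Lemma minimizer_D_NA_ge g G : convex_on P g -> represents P g G ->
  fine (g 0) - dot G ell <= Num.sqrt (dot F F) * Num.sqrt (dot G G).
Proof.
move=> cg rG; have [iG gG] := rG.
have [_ f_le _ _] := f_min.
have := f_le g (conj cg (represents_L2 mP rG)); rewrite W_ell_minimizer.
have [ap NE pG] := affine_proj_residual rG.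
set p := affine_proj P g in ap NE pG.
have ip := i_aff ap.
rewrite /W_ell -/p NE (D_NA_represents cg rG) eqe /=.
set H := fun y => G y - p y in NE pG *.
have iH : sqint H by exact: sq_integrableB.
case: ifPn => [/eqP|] r0.
  move=> _; apply: le_trans (_ : 0 <= _); last by rewrite mulr_ge0 ?sqrtr_ge0.
  have HH : dot H H <= 0 by rewrite -sqrtr_eq0 r0.
  have H0 := dot_eq0 mP iH HH.
  have Gp : {ae mu, forall y, P y -> G y = p y}.
    by apply: filterS H0 => y H0 /H0/eqP; rewrite subr_eq0 => /eqP.
  rewrite subr_le0 (eq_dot_ae _ Gp) dot_ricci//.
  rewrite -lee_fin -(represents_interior_fin cg rG P0).
  apply: (ae_le_continuous cg (@continuous_affine_fun _ _ _ ap 0)) P0.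
  by apply: filterS2 gG Gp => y gG Gp Py; rewrite gG// Gp.
have r_gt0 : 0 < Num.sqrt (dot H H) by rewrite lt_neqAle eq_sym r0 sqrtr_ge0.
rewrite ler_pdivlMr// => le1.
have HG : dot H H <= dot G G.
  have -> : dot G G = dot H H + dot p p.
    have -> : dot G G = dot (fun y => H y + p y) (fun y => H y + p y).
      by apply: eq_Rintegral => y _; rewrite /H subrK.
    by rewrite dot_sqrD// (pG p ap) mulr0 addr0.
  by rewrite lerDl dot_ge0.
have : Num.sqrt (dot F F) * Num.sqrt (dot H H) <=
       Num.sqrt (dot F F) * Num.sqrt (dot G G).
  by apply: ler_wpM2l; [exact: sqrtr_ge0|exact: ler_wsqrtr].
by lra.
Qed.

(** Apply the previous bound to [f + t g], replace the product of norms by the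
    mean of the squared norms to remove the square roots, divide by [t] and let
    [t] tend to [0]. *)
Lemma minimizer_first_variation g G : convex_on P g -> represents P g G ->
  fine (g 0) <= dot G (fun y => F y + ell y).
Proof.
move=> cg rG; have [iG gG] := rG.
have il := i_aff ell_affine.
rewrite dotC dotDl// [dot ell G]dotC.
have key t : 0 < t -> fine (g 0) - dot G ell - dot F G <= t / 2 * dot G G.
  move=> t0.
  have itG := sq_integrableZ mP t iG.
  have ct := convex_onD f_convex (convex_onZ t0 cg).
  have rt := representsD mP f_F (representsZ mP t rG).
  have := minimizer_D_NA_ge ct rt.
  set N := dot (fun y => F y + t * G y) (fun y => F y + t * G y).
  have N0 : 0 <= N by exact: dot_ge0.
  have NE : N = dot F F + 2 * (t * dot F G) + t * (t * dot G G).
    have E1 : dot F (fun y => t * G y) = t * dot F G.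
      by rewrite dotC dotZl// dotC.
    have E2 : dot (fun y => t * G y) (fun y => t * G y) = t * (t * dot G G).
      by rewrite dotZl// dotC dotZl.
    by rewrite /N dot_sqrD// E1 E2.
  have -> : fine (f 0%R + t%:E * g 0%R)%E = fine (f 0) + t * fine (g 0).
    rewrite (represents_interior_fin f_convex f_F P0).
    by rewrite (represents_interior_fin cg rG P0).
  rewrite minimizer_value0 dotDl// (minimizer_orthogonal ell_affine) add0r.
  rewrite dotZl//.
  have := sqr_ge0 (Num.sqrt (dot F F) - Num.sqrt N).
  rewrite sqrrB !sqr_sqrtr ?dot_ge0// mulr2n => amgm le1.
  rewrite -(ler_pM2l t0).
  by move: amgm le1; rewrite NE; lra.
rewrite leNgt; apply/negP => lt1.
pose d := fine (g 0) - dot G ell - dot F G.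
have d0 : 0 < d by rewrite /d; lra.
have GG := dot_ge0 mu P G.
have GG1 : 0 < dot G G + 1 by rewrite ltr_wpDl.
(* this [t] makes [t / 2 * dot G G] smaller than [d] *)
have := key (d / (dot G G + 1)) (divr_gt0 d0 GG1).
rewrite -/d -mulrA mulrAC ler_pdivlMr//.
by nra.
Qed.

End fixed_minimizer.
End minimizer.

(** * The optimal density *)

Section optimal_density.
Context (R : realType) (n : nat) (P : set 'rV[R]_n).
Hypothesis P_body : convex_body P.
Hypothesis P0 : P° 0.
Local Notation mu := (lebesgue_rV R n).
Local Notation sqint := (sq_integrable mu P).
Local Notation dot := (L2dot mu P).
Implicit Types (h a F G B C : 'rV[R]_n -> R) (f g b c : 'rV[R]_n -> \bar R).

Let mP : measurable P := convex_body_measurable P_body.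

Variables (b : 'rV[R]_n -> \bar R) (B : 'rV[R]_n -> R).
Hypothesis b_convex : convex_on P b.
Hypothesis b_B : represents P b B.
Hypothesis B_centered : centered P B.
Hypothesis dot_BB : dot B B = fine (b 0).
(* The variational inequality; [dot_BB] is the case of equality [g = b]. *)
Hypothesis b_variation : forall g G, convex_on P g -> represents P g G ->
  fine (g 0) <= dot G B.

Let iB : sqint B := b_B.1.

Let b0E : b 0 = (fine (b 0))%:E := represents_interior_fin b_convex b_B P0.

(** Test the variational inequality on [max(0, b)]. *)
Lemma optimal_ae_ge0 : {ae mu, forall y, P y -> 0 <= B y}.
Proof.
have rM := represents_max0 mP b_B.
have [iM _] := rM.
have := b_variation (convex_on_max0 b_convex) rM.
rewrite b0E -EFin_max /= => le1.
have : dot (fun y => B y - Num.max 0 (B y)) B <= 0.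
  rewrite dotBl// dot_BB subr_le0; apply: le_trans le1.
  by rewrite le_max lexx orbT.
move=> /(dot_ge0_eq0 mP (sq_integrableB mP iB iM) iB) H.
have {}H : {ae mu, forall y, P y -> (B y - Num.max 0 (B y)) * B y = 0}.
  apply: H; apply: aeW => y _; case: (leP 0 (B y)) => By.
    by rewrite subrr mul0r.
  by rewrite subr0 -expr2 sqr_ge0.
apply: filterS H => y H /H; case: (leP 0 (B y)) => // By /eqP.
by rewrite subr0 mulf_eq0 orbb lt_eqF.
Qed.

Lemma optimal_ge0 y : P y -> (0 <= b y)%E.
Proof.
have a0 : affine_fun (fun _ : 'rV[R]_n => 0 : R) by exact: affine_fun_cst.
move=> Py; apply: (ae_ge_affine P_body (h := fun=> 0) b_convex a0) Py.
apply: filterS2 b_B.2 optimal_ae_ge0 => x bB B0 Px.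
by rewrite bB// ltry lee_fin B0.
Qed.

(** Test the variational inequality on [max(0, a)] with [a] supporting [b] at
    [0]: it lies below [b] and has the same value at [0]. *)
Lemma optimal_ae_pospart : exists2 a, affine_fun a &
  {ae mu, forall y, P y -> B y = Num.max 0 (a y)}.
Proof.
have b_fin y : P° y -> (b y < +oo)%E.
  by move=> yP; rewrite (represents_interior_fin b_convex b_B yP) ltry.
have [a aa [a0 ab]] := exists_affine_support P_body P0 b_convex b_fin.
exists a => //.
pose m y := Num.max 0 (a y).
have im : sqint m := pospart_sq_integrable P_body aa.
have a0_ge0 : 0 <= a 0.
  by rewrite -lee_fin -a0; apply: optimal_ge0; exact: interior_subset.
have := b_variation (pospart_convex P aa) (represents_EFin im).
rewrite /= max_r// => le1.
have ae_m : {ae mu, forall y, P y -> 0 <= B y /\ m y <= B y}.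
  apply: filterS2 b_B.2 optimal_ae_ge0 => y bB B0 Py; split; first exact: B0.
  by rewrite /m ge_max B0//= -lee_fin -bB// ab.
have : dot (fun y => B y - m y) B <= 0.
  by rewrite dotBl// dot_BB a0 subr_le0.
move=> /(dot_ge0_eq0 mP (sq_integrableB mP iB im) iB) H.
have {}H : {ae mu, forall y, P y -> (B y - m y) * B y = 0}.
  apply: H; apply: filterS ae_m => y mB /mB[B0 mB'].
  by rewrite mulr_ge0// subr_ge0.
apply: filterS2 H ae_m => y H mB Py; have [B0 mB'] := mB Py.
have /eqP := H Py; rewrite mulf_eq0 subr_eq0 => /orP[/eqP//|/eqP By].
by apply/eqP; rewrite eq_le -/(m y) mB' andbT By le_max lexx.
Qed.

Lemma optimal_frakB : frakB P b.
Proof. exact: centered_frakB b_B optimal_ae_ge0 B_centered. Qed.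

Lemma optimal_integral_sq : (\int[mu]_(y in P) (b y ^+ 2))%E = b 0.
Proof. by rewrite (represents_integral_sq mP b_B) dot_BB -b0E. Qed.

Lemma optimal_pospart : exists a, [/\ affine_fun a,
  centered P (fun y => Num.max 0 (a y)) &
  represents P b (fun y => Num.max 0 (a y))].
Proof.
have [a aa Bm] := optimal_ae_pospart; exists a; split=> //.
  by move=> h /B_centered <-; apply/esym/eq_dot_ae.
split; first exact: pospart_sq_integrable.
by apply: filterS2 b_B.2 Bm => y bB Bm Py; rewrite bB// Bm.
Qed.

Lemma optimal_min_norm : is_unique_min_norm P b.
Proof.
by have [a [aa mh rb]] := optimal_pospart; exact: pospart_min_norm rb.
Qed.

Lemma optimal_normalized_pospart : exists2 a,
  unique (is_normalized_positive_part P) a &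
  forall y, P° y -> b y = (Num.max 0 (a y))%:E.
Proof.
have [a [aa mh rb]] := optimal_pospart.
have na : is_normalized_positive_part P a by exact/normalized_pospartP.
exists a; last exact: ae_eq_pospart rb.2.
by split=> // a' na'; exact: pospart_unique na na'.
Qed.

(** The chain [|c|^2 >= 2 <c, b> - |b|^2 >= <c, b> >= c(0)]; if its ends are
    equal, then [|c - b|^2 <= 0]. The converse compares integrals over [P] of
    functions equal on the interior, so it needs the boundary to be null. *)
Lemma optimal_le_convex c : convex_on P c -> frakB P c ->
  (c 0%R <= \int[mu]_(y in P) (c y ^+ 2))%E /\
  ((\int[mu]_(y in P) (c y ^+ 2))%E = c 0%R <-> forall y, P° y -> c y = b y).
Proof.
move=> cc cB; have [a [aa mh rb]] := optimal_pospart.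
pose m y := Num.max 0 (a y).
have im : sqint m := rb.1.
have bE := ae_eq_pospart P_body aa b_convex rb.2.
have Bm : {ae mu, forall y, P y -> B y = m y}.
  apply: filterS2 b_B.2 rb.2 => y bB bm Py; apply: EFin_inj.
  by rewrite -bB// bm.
have dot_Bm G : dot G B = dot G m by rewrite dotC (eq_dot_ae _ Bm) dotC.
have dot_mm : dot m m = fine (b 0) by rewrite -dot_BB dot_Bm dotC -dot_Bm dotC.
have [C rC] := frakB_represents P_body cB; have [iC cC] := rC.
have [C0 Ch] := frakB_centered P_body cB rC.
have c0E := represents_interior_fin cc rC P0.
have mC := pospart_dot_min P_body aa mh iC C0 Ch.
have sqCm := dot_ge0 mu P (fun y => C y - m y).
have := b_variation cc rC.
move: sqCm; rewrite dot_Bm dot_sqrB// => sqCm cb.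
rewrite (represents_integral_sq mP rC) c0E; split.
  by rewrite lee_fin; lra.
split=> [[CC] y yP|cbE].
  rewrite bE//; apply: (ae_eq_pospart P_body aa cc) => //.
  have : dot (fun y => C y - m y) (fun y => C y - m y) <= 0.
    by rewrite dot_sqrB//; lra.
  move=> /(dot_eq0 mP (sq_integrableB mP iC im)) Cm0.
  apply: filterS2 cC Cm0 => x cC Cm0 Px; rewrite cC//; congr EFin.
  by apply/eqP; rewrite -subr_eq0 Cm0.
have Cm : {ae mu, forall y, P y -> C y = m y}.
  have bd0 : {ae mu, forall y, P y -> P° y}.
    exists (P `\` P°); split.
    - apply: measurableD => //; apply: open_measurable_rV; exact: open_interior.
    - exact: convex_body_boundary_null.
    - by move=> y /= /not_implyP.
  apply: filterS2 cC bd0 => y cC bd0 Py; apply: EFin_inj.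
  by rewrite -cC// -bE ?cbE//; exact: bd0.
rewrite (eq_dot_ae _ Cm) dotC (eq_dot_ae _ Cm) dot_mm.
by rewrite -c0E cbE// b0E.
Qed.

End optimal_density.

Theorem theorem50 (R : realType) (n : nat) (P : set 'rV[R]_n)
    (P_body : convex_body P) (P_0 : P° 0) :
  (inf [set ricci_affine P y | y in P] < 0 ->
   forall f : 'rV[R]_n -> \bar R, is_normalized_minimizer P f ->
   let b : 'rV[R]_n -> \bar R := fun y => (f y + (ricci_affine P y)%:E)%E in
   [/\ (* (1) *)
       [/\ forall y, P y -> (0 <= b y)%E,
           (\int[lebesgue_rV R n]_(y in P) b y)%E = 1%E,
           forall i : 'I_n,
             (\int[lebesgue_rV R n]_(y in P) ((y ord0 i)%:E * b y))%E = 0%E,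
           frakB P b &
           (\int[lebesgue_rV R n]_(y in P) (b y ^+ 2))%E = b 0%R],
       (* (2) *)
       is_unique_min_norm P b,
       (* (3) *)
       forall c : 'rV[R]_n -> \bar R, convex_on P c -> frakB P c ->
         (c 0%R <= \int[lebesgue_rV R n]_(y in P) (c y ^+ 2))%E /\
         ((\int[lebesgue_rV R n]_(y in P) (c y ^+ 2))%E = c 0%R <->
          forall y, P° y -> c y = b y) &
       (* (4) *)
       exists2 a : 'rV[R]_n -> R,
         unique (is_normalized_positive_part P) a &
         forall y, P° y -> b y = (Num.max 0 (a y))%:E]) /\
  (* (5) *)
  (0 <= inf [set ricci_affine P y | y in P] ->
   is_unique_min_norm P (EFin \o ricci_affine P)).
Proof.
split=> [_ f f_min b|]; last exact: ricci_min_norm.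
have [[f_convex fL2] _ _ _] := f_min.
have mP := convex_body_measurable P_body.
have [F f_F] := L2_represents mP fL2; have [iF _] := f_F.
have [ell_affine _] := ricci_affineP P_body P_0.
have i_ell := sq_integrable_affine P_body ell_affine.
have F_orth := minimizer_orthogonal P_body P_0 f_min f_F.
have b_B : represents P b (fun y => F y + ricci_affine P y).
  exact: (representsD mP f_F (represents_EFin i_ell)).
have b_convex : convex_on P b.
  exact: (convex_onD f_convex (convex_on_affine P ell_affine)).
have B_centered : centered P (fun y => F y + ricci_affine P y).
  move=> h ah; have ih := sq_integrable_affine P_body ah.
  by rewrite dotDl// F_orth// add0r dotC dot_ricci.
have dot_BB : L2dot (lebesgue_rV R n) P (fun y => F y + ricci_affine P y)
    (fun y => F y + ricci_affine P y) = fine (b 0).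
  rewrite dot_sqrD// (F_orth _ ell_affine) mulr0 addr0 (dot_ricci P_body P_0)//.
  by rewrite /b (represents_interior_fin f_convex f_F P_0)//=
    (minimizer_value0 P_body f_min f_F).
have b_variation g G (cg : convex_on P g) (rG : represents P g G) :
    fine (g 0) <= L2dot (lebesgue_rV R n) P G (fun y => F y + ricci_affine P y).
  exact: (minimizer_first_variation P_body P_0 f_min f_F).
have b_frakB :=
  optimal_frakB P_body P_0 b_convex b_B B_centered dot_BB b_variation.
split.
- have [_ _ ? ?] := b_frakB; split=> //; first exact: optimal_ge0 b_variation.
  exact: optimal_integral_sq b_B dot_BB.
- exact: optimal_min_norm b_variation.
- move=> c cc cB.
  exact: (optimal_le_convex P_body P_0 b_convex b_B B_centered dot_BB).
- exact: optimal_normalized_pospart b_variation.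
Qed.
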